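(* Let $(B,\Phi,\sqsubseteq)$ be a RUSQ algebra and let $M$ be in $\mathcal{F}(\Delta)$. Then $M$ is $\Delta$-semisimple if and only if the number of simple summands of $\operatorname{Soc}M$ (in a decomposition into simple modules) coincides with the number of factors in a $\Delta$-filtration of $M$. Moreover, any submodule of a $\Delta$-semisimple $B$-module is still $\Delta$-semisimple.
   Context: All modules are finitely generated left modules over an Artin algebra $B$. Let $(\Phi,\sqsubseteq)$ be a finite poset labelling the isomorphism classes of simple $B$-modules $L_i$ ($i\in\Phi$), with projective covers $P_i$ and injective hulls $Q_i$. The standard modules are $\Delta(i)=P_i/\operatorname{Tr}\big(\bigoplus_{j\not\sqsubseteq i}P_j,P_i\big)$, where $\operatorname{Tr}(X,N)$ is the sum of the images of all homomorphisms $X\to N$. $\mathcal{F}(\Delta)$ is the class of modules having a $\Delta$-filtration, i.e. a filtration whose factors are isomorphic to standard modules; $(N:\Delta(i))$ is the multiplicity of $\Delta(i)$ in such a filtration (well defined), and $[N:L]$ denotes composition multiplicity. $(B,\Phi,\sqsubseteq)$ is quasihereditary if for all $i\in\Phi$: $[\Delta(i):L_i]=1$; $P_i\in\mathcal{F}(\Delta)$; $(P_i:\Delta(i))=1$, and $(P_i:\Delta(j))\neq0$ implies $j\sqsupseteq i$. A quasihereditary algebra is a right ultra strongly quasihereditary (RUSQ) algebra if (A1) $\operatorname{Rad}\Delta(i)\in\mathcal{F}(\Delta)$ for all $i\in\Phi$, and (A2) $Q_i\in\mathcal{F}(\Delta)$ for all $i\in\Phi$ with $\operatorname{Rad}\Delta(i)=0$.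 A module is $\Delta$-semisimple if it is a (finite) direct sum of standard modules. *)

(* Defs.v *)
From HB Require Import structures.
From mathcomp Require Import all_boot all_order all_algebra.
From mathcomp Require Import boolp classical_sets.

Set Implicit Arguments.
Unset Strict Implicit.
Unset Printing Implicit Defensive.

Import Order.TTheory GRing.Theory.
Local Open Scope ring_scope.
Local Open Scope quotient_scope.

Section Modules.
Variable B : pzRingType.
Implicit Types M N X Y P Q L : lmodType B.

Definition surjective_map (A C : Type) (f : A -> C) := forall y, exists x, f x = y.

Definition isomorphic M N : Prop := exists f : {linear M -> N}, bijective f.

Definition finitely_generated M : Prop :=
  exists (n : nat) (g : 'I_n -> M),
    forall x, exists a : 'I_n -> B, x = \sum_(k < n) a k *: g k.

(* Submodules of M are the terms of the library type submodClosed M. *)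

Definition is_zero_submod M (S : submodClosed M) : Prop :=
  forall x, x \in S -> x = 0.
Definition is_full_submod M (S : submodClosed M) : Prop := forall x, x \in S.

Definition submod_type M (S : submodClosed M) : Type := {x : M | x \in S}.

Section SubmodType.
Variables (M : lmodType B) (S : submodClosed M).
HB.instance Definition _ := SubChoice.on (submod_type S).
HB.instance Definition _ := [SubChoice_isSubLmodule of submod_type S by <:].
End SubmodType.

Definition submodule M (S : submodClosed M) : lmodType B := submod_type S.

Section QuotType.
Variables (M : lmodType B) (S : submodClosed M).

Definition quot_rel (x y : M) := x - y \in S.

Fact quot_rel_equiv : equiv_class_of quot_rel.
Proof.
split=> [x|x y|y x z]; rewrite /quot_rel.
- by rewrite subrr rpred0.
- by apply/idP/idP => /(rpredZ (-1)); rewrite scaleN1r opprB.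
move=> xy yz; rewrite -(subrK y x) -addrA; exact: rpredD.
Qed.

Canonical quot_equiv := EquivRelPack quot_rel_equiv.
Canonical quot_encModRel := defaultEncModRel quot_rel.

Definition quot_type : Type := {eq_quot quot_rel}.
HB.instance Definition _ : EqQuotient M quot_rel quot_type :=
  EqQuotient.on quot_type.
HB.instance Definition _ := Choice.on quot_type.

Local Lemma eq_piP (x y : M) :
  reflect (\pi_quot_type x = \pi_quot_type y) (x - y \in S).
Proof. exact: (@eqquotP _ quot_rel quot_type). Qed.

Definition quot_add (u v : quot_type) : quot_type := \pi_quot_type (repr u + repr v).
Definition quot_opp (u : quot_type) : quot_type := \pi_quot_type (- repr u).
Definition quot_scale (a : B) (u : quot_type) : quot_type := \pi_quot_type (a *: repr u).

Local Lemma repr_piB (x : M) : repr (\pi_quot_type x) - x \in S.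
Proof. by apply/eq_piP; rewrite reprK. Qed.

Local Lemma quot_addE (x y : M) :
  quot_add (\pi_quot_type x) (\pi_quot_type y) = \pi_quot_type (x + y).
Proof.
by apply/eq_piP; rewrite opprD addrACA rpredD ?repr_piB.
Qed.

Local Lemma quot_oppE (x : M) : quot_opp (\pi_quot_type x) = \pi_quot_type (- x).
Proof.
by apply/eq_piP; rewrite -opprD -[- (_ - _)]scaleN1r rpredZ ?repr_piB.
Qed.

Local Lemma quot_scaleE (a : B) (x : M) :
  quot_scale a (\pi_quot_type x) = \pi_quot_type (a *: x).
Proof. by apply/eq_piP; rewrite -scalerBr rpredZ ?repr_piB. Qed.

Local Lemma quot_elim (T : quot_type -> Prop) :
  (forall x, T (\pi_quot_type x)) -> forall u, T u.
Proof. by move=> Tpi u; rewrite -(reprK u). Qed.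

Local Lemma quot_addA : associative quot_add.
Proof.
by apply: quot_elim => x; apply: quot_elim => y; apply: quot_elim => z; rewrite !quot_addE addrA.
Qed.
Local Lemma quot_addC : commutative quot_add.
Proof. by apply: quot_elim => x; apply: quot_elim => y; rewrite !quot_addE addrC. Qed.
Local Lemma quot_add0 : left_id (\pi_quot_type 0) quot_add.
Proof. by apply: quot_elim => x; rewrite quot_addE add0r. Qed.
Local Lemma quot_addN : left_inverse (\pi_quot_type 0) quot_opp quot_add.
Proof. by apply: quot_elim => x; rewrite quot_oppE quot_addE addNr. Qed.

HB.instance Definition _ :=
  GRing.isZmodule.Build quot_type quot_addA quot_addC quot_add0 quot_addN.

Local Lemma quot_piD (x y : M) :
  \pi_quot_type x + \pi_quot_type y = \pi_quot_type (x + y).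
Proof. exact: quot_addE. Qed.

Local Lemma quot_scaleA (a b : B) (u : quot_type) :
  quot_scale a (quot_scale b u) = quot_scale (a * b) u.
Proof. by move: u; apply: quot_elim => x; rewrite !quot_scaleE scalerA. Qed.
Local Lemma quot_scale1 : left_id 1 quot_scale.
Proof. by apply: quot_elim => x; rewrite quot_scaleE scale1r. Qed.
Local Lemma quot_scaleDr : right_distributive quot_scale +%R.
Proof.
move=> a; apply: quot_elim => x; apply: quot_elim => y.
by rewrite !(quot_piD, quot_scaleE) scalerDr.
Qed.
Local Lemma quot_scaleDl (u : quot_type) :
  {morph quot_scale^~ u : a b / a + b}.
Proof.
by move: u; apply: quot_elim => x a b; rewrite /= !quot_scaleE quot_piD scalerDl.
Qed.

HB.instance Definition _ := GRing.Zmodule_isLmodule.Build B quot_type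
  quot_scaleA quot_scale1 quot_scaleDr quot_scaleDl.

Definition quotient : lmodType B := quot_type.

Definition quot_proj (x : M) : quotient := \pi_quot_type x.

Local Lemma quot_proj_linear : linear quot_proj.
Proof.
move=> a x y; rewrite /quot_proj -quot_piD; congr (_ + _).
by rewrite -quot_scaleE.
Qed.
HB.instance Definition _ :=
  GRing.isLinear.Build B M quotient *:%R quot_proj quot_proj_linear.

Fact quot_projP (x y : M) : reflect (quot_proj x = quot_proj y) (x - y \in S).
Proof. exact: eq_piP. Qed.

Fact quot_proj_surj : surjective_map quot_proj.
Proof. by apply: quot_elim => x; exists x. Qed.
End QuotType.

(* U restricted to a submodule of V; it is all of U when U is contained in V. *)
Definition restrict_pred M (V U : submodClosed M) : {pred submodule V} :=
  [pred x | val x \in U].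
Arguments restrict_pred : clear implicits.
Arguments restrict_pred {M} V U _.

Section Restrict.
Variables (M : lmodType B) (V U : submodClosed M).
Fact restrict_closed : submod_closed (restrict_pred V U).
Proof.
split=> [|a x y]; rewrite !inE; first exact: rpred0.
by move=> xU yU; rewrite /= rpredD // rpredZ.
Qed.
HB.instance Definition _ :=
  GRing.isSubmodClosed.Build B (submodule V) (restrict_pred V U) restrict_closed.
End Restrict.

Definition subquotient M (V U : submodClosed M) : lmodType B :=
  quotient (restrict_pred V U : submodClosed (submodule V)).

Section DirectSum.
Variables (I : finType) (V : I -> lmodType B).

Definition dsum_type : Type := {dffun forall i, V i}.
HB.instance Definition _ := Choice.on dsum_type.
Implicit Types u v : dsum_type.

Definition dsum_zero : dsum_type := [ffun i => 0 : V i].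
Definition dsum_add u v : dsum_type := [ffun i => u i + v i].
Definition dsum_opp u : dsum_type := [ffun i => - u i].
Definition dsum_scale (a : B) u : dsum_type := [ffun i => a *: u i].

Local Lemma dsum_addA : associative dsum_add.
Proof. by move=> u v w; apply/ffunP=> i; rewrite !ffunE addrA. Qed.
Local Lemma dsum_addC : commutative dsum_add.
Proof. by move=> u v; apply/ffunP=> i; rewrite !ffunE addrC. Qed.
Local Lemma dsum_add0 : left_id dsum_zero dsum_add.
Proof. by move=> u; apply/ffunP=> i; rewrite !ffunE add0r. Qed.
Local Lemma dsum_addN : left_inverse dsum_zero dsum_opp dsum_add.
Proof. by move=> u; apply/ffunP=> i; rewrite !ffunE addNr. Qed.

HB.instance Definition _ :=
  GRing.isZmodule.Build dsum_type dsum_addA dsum_addC dsum_add0 dsum_addN.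

Local Lemma dsum_scaleA (a b : B) u :
  dsum_scale a (dsum_scale b u) = dsum_scale (a * b) u.
Proof. by apply/ffunP=> i; rewrite !ffunE scalerA. Qed.
Local Lemma dsum_scale1 : left_id 1 dsum_scale.
Proof. by move=> u; apply/ffunP=> i; rewrite !ffunE scale1r. Qed.
Local Lemma dsum_scaleDr : right_distributive dsum_scale +%R.
Proof. by move=> a u v; apply/ffunP=> i; rewrite !ffunE scalerDr. Qed.
Local Lemma dsum_scaleDl u : {morph dsum_scale^~ u : a b / a + b}.
Proof. by move=> a b; apply/ffunP=> i; rewrite !ffunE scalerDl. Qed.

HB.instance Definition _ := GRing.Zmodule_isLmodule.Build B dsum_type
  dsum_scaleA dsum_scale1 dsum_scaleDr dsum_scaleDl.

Definition direct_sum : lmodType B := dsum_type.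
End DirectSum.

Definition simple_module M : Prop :=
  (exists x : M, x != 0) /\
  forall S : submodClosed M, is_zero_submod S \/ is_full_submod S.

Definition maximal_submod M (S : submodClosed M) : Prop :=
  ~ is_full_submod S /\
  forall T : submodClosed M, {subset S <= T} -> {subset T <= S} \/ is_full_submod T.

Definition rad_pred M : {pred M} :=
  fun x => `[< forall S : submodClosed M, maximal_submod S -> x \in S >].

Section Rad.
Variable M : lmodType B.
Fact rad_closed : submod_closed (@rad_pred M).
Proof.
split=> [|a x y]; rewrite !unfold_in.
  by apply/asboolP=> S _; exact: rpred0.
move=> /asboolP Hx /asboolP Hy; apply/asboolP=> S Smax.
by rewrite rpredD ?rpredZ ?Hx ?Hy.
Qed.
HB.instance Definition _ :=
  GRing.isSubmodClosed.Build B M (@rad_pred M) rad_closed.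
End Rad.
Definition Rad M : submodClosed M := @rad_pred M.

(* The finite sums of elements satisfying G. *)
Definition finite_sums M (G : M -> Prop) : {pred M} :=
  fun x => `[< exists2 s : seq M,
    (forall z, z \in s -> G z) & x = \sum_(z <- s) z >].

Fact finite_sums_closed M (G : M -> Prop) :
  (forall a z, G z -> G (a *: z)) -> submod_closed (finite_sums G).
Proof.
move=> GZ; split=> [|a x y]; rewrite !unfold_in.
  by apply/asboolP; exists [::]; rewrite ?big_nil.
move=> /asboolP[s Gs ->] /asboolP[t Gt ->]; apply/asboolP.
exists ([seq a *: z | z <- s] ++ t); last first.
  by rewrite big_cat big_map scaler_sumr.
move=> z; rewrite mem_cat => /orP[/mapP[z' /Gs Gz' ->]|/Gt //].
exact: GZ.
Qed.

Definition tr_pred X N : {pred N} :=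
  finite_sums (fun z => exists (f : {linear X -> N}) (x : X), z = f x).

Section Trace.
Variables X N : lmodType B.
Fact tr_closed : submod_closed (@tr_pred X N).
Proof.
apply: finite_sums_closed => a _ [f [x ->]].
by exists f, (a *: x); rewrite linearZ.
Qed.
HB.instance Definition _ :=
  GRing.isSubmodClosed.Build B N (@tr_pred X N) tr_closed.
End Trace.
Definition Tr X N : submodClosed N := @tr_pred X N.

Definition soc_pred M : {pred M} :=
  finite_sums (fun z =>
    exists2 S : submodClosed M, simple_module (submodule S) & z \in S).

Section Soc.
Variable M : lmodType B.
Fact soc_closed : submod_closed (@soc_pred M).
Proof.
apply: finite_sums_closed => a z [S Ssimple Sz].
by exists S; rewrite ?rpredZ.
Qed.
HB.instance Definition _ :=
  GRing.isSubmodClosed.Build B M (@soc_pred M) soc_closed.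
End Soc.
Definition Soc M : submodClosed M := @soc_pred M.

Definition projective P : Prop :=
  forall (X Y : lmodType B) (g : {linear X -> Y}) (f : {linear P -> Y}),
    finitely_generated X -> finitely_generated Y -> surjective_map g ->
    exists h : {linear P -> X}, forall x, g (h x) = f x.

Definition injective_module Q : Prop :=
  forall (X Y : lmodType B) (g : {linear X -> Y}) (f : {linear X -> Q}),
    finitely_generated X -> finitely_generated Y -> injective g ->
    exists h : {linear Y -> Q}, forall x, h (g x) = f x.

(* The kernel of the surjection p is superfluous in P. *)
Definition is_projective_cover P M : Prop :=
  [/\ finitely_generated P, projective P &
    exists2 p : {linear P -> M}, surjective_map p &
      forall S : submodClosed P,
        (forall x, exists2 y, y \in S & p (x - y) = 0) -> is_full_submod S].

(* The image of the injection e is essential in Q. *)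
Definition is_injective_hull Q M : Prop :=
  [/\ finitely_generated Q, injective_module Q &
    exists2 e : {linear M -> Q}, injective e &
      forall S : submodClosed Q,
        (forall x, e x \in S -> e x = 0) -> is_zero_submod S].

(* 0 = F_0 <= ... <= F_n = M with successive factors F_{k+1}/F_k isomorphic   *)
(* to X_k; the values of F beyond n are irrelevant.                           *)
Definition has_filtration M (n : nat) (X : 'I_n -> lmodType B) : Prop :=
  exists F : nat -> submodClosed M,
    [/\ is_zero_submod (F 0%N), is_full_submod (F n) &
      forall k : 'I_n, {subset F k <= F k.+1} /\
                       isomorphic (subquotient (F k.+1) (F k)) (X k)].

(* In the numerical invariants below, xget 0 selects the value that is common *)
(* to all filtrations (or decompositions) of the module, and is 0 if there    *)
(* are none.                                                                  *)

Definition comp_mult N L : nat :=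
  xget 0%N [set m | exists (n : nat) (X : 'I_n -> lmodType B),
    [/\ forall k, simple_module (X k), has_filtration N X &
        m = #|[set k : 'I_n | `[< isomorphic (X k) L >]]|]].

Definition nb_simple_summands N : nat :=
  xget 0%N [set n | exists X : 'I_n -> lmodType B,
    (forall k, simple_module (X k)) /\ isomorphic N (direct_sum X)].

End Modules.
Arguments restrict_pred {B M} V U _.

Definition artinian_ring (K : comPzRingType) : Prop :=
  forall I : nat -> submodClosed K^o,
    (forall n, {subset I n.+1 <= I n}) ->
    exists n, forall m, (n <= m)%N -> I m =i I n.

(* pzRingType is used so that the zero algebra is not excluded. *)
Definition artin_algebra (B : pzRingType) : Prop :=
  exists (K : comPzRingType) (phi : {rmorphism K -> B}),
    [/\ artinian_ring K,
        forall k b, phi k * b = b * phi k &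
        exists (n : nat) (g : 'I_n -> B),
          forall b, exists a : 'I_n -> K, b = \sum_(k < n) phi (a k) * g k].

Section Quasihereditary.
Variables (B : pzRingType) (d : Order.disp_t) (Phi : finPOrderType d).
Implicit Types L P Q : Phi -> lmodType B.
Implicit Types M : lmodType B.

Definition represents_simples L : Prop :=
  [/\ forall i, simple_module (L i),
      forall i j, isomorphic (L i) (L j) -> i = j &
      forall S : lmodType B, simple_module S -> exists i, isomorphic S (L i)].

Definition Delta P (i : Phi) : lmodType B :=
  quotient (Tr (direct_sum (fun j : {j : Phi | ~~ (j <= i)%O} => P (val j)))
               (P i)).

Definition Delta_filtration P M (n : nat) (c : 'I_n -> Phi) : Prop :=
  has_filtration M (fun k => Delta P (c k)).

Definition in_F_Delta P M : Prop :=
  exists (n : nat) (c : 'I_n -> Phi), Delta_filtration P M c.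

Definition Delta_mult P M (i : Phi) : nat :=
  xget 0%N [set m | exists (n : nat) (c : 'I_n -> Phi),
    Delta_filtration P M c /\ m = #|[set k : 'I_n | c k == i]|].

Definition Delta_length P M : nat :=
  xget 0%N [set n | exists c : 'I_n -> Phi, Delta_filtration P M c].

Definition quasihereditary L P : Prop :=
  forall i,
    [/\ comp_mult (Delta P i) (L i) = 1%N,
        in_F_Delta P (P i),
        Delta_mult P (P i) i = 1%N &
        forall j, Delta_mult P (P i) j <> 0%N -> (i <= j)%O].

Definition RUSQ L P Q : Prop :=
  [/\ quasihereditary L P,
      forall i, in_F_Delta P (submodule (Rad (Delta P i))) &
      forall i, is_zero_submod (Rad (Delta P i)) -> in_F_Delta P (Q i)].

Definition Delta_semisimple P M : Prop :=
  exists (n : nat) (c : 'I_n -> Phi),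
    isomorphic M (direct_sum (fun k => Delta P (c k))).

End Quasihereditary.

(* Main.v *)
(** By (A1), a nonzero homomorphism from a standard module to a module in
    F(Delta) is injective.  By (A2), Rad Delta(i) is then zero or standard: if
    it had a second Delta-factor, some nonzero homomorphism from Delta(i) to an
    injective module Q_t in F(Delta) would kill the first one.  So the nonzero
    submodules of Delta(i) are standard, Delta(i) has a simple essential socle,
    and every homomorphism P_a -> Delta(l) factors through Delta(a).  The last
    property lets one split off the image of any projection of a submodule of a
    Delta-semisimple module, whence the second claim.

    Along a Delta-filtration of M, each factor adds at most one simple summand
    to the socle.  If each adds exactly one, then in
    0 -> N -> M -> Delta(i) -> 0 some simple submodule of M avoids N.  The maps
    N -> Delta(c) -> Q_t extend to M so as to kill it, and such an extension
    lands in the bottom factor Delta(m) of Q_t, because it induces a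
    non-injective map Delta(i) -> Q_t / Delta(m).  Thus M embeds into a sum of
    standard modules, and the second claim applies. *)
From HB Require Import structures.
Require Import Defs.
From mathcomp Require Import all_boot all_order all_algebra.
From mathcomp Require Import boolp classical_sets.
Set Implicit Arguments.
Unset Strict Implicit.
Unset Printing Implicit Defensive.
Import Order.TTheory GRing.Theory.
Local Open Scope ring_scope.
(** * Linear maps and exact sequences *)

Section Maps.
Variable B : pzRingType.
Implicit Types K M N W X Y Z : lmodType B.

Lemma linear_bundle M N (f : M -> N) : linear f ->
  exists g : {linear M -> N}, g =1 f.
Proof.
move=> lf; pose F := GRing.isLinear.Build B M N *:%R f lf.
pose g : {linear M -> N} := HB.pack f F.
by exists g.
Qed.

Lemma submod_bundle M (S : M -> Prop) :
    S 0 -> (forall a x y, S x -> S y -> S (a *: x + y)) ->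
  exists T : submodClosed M, forall x, x \in T <-> S x.
Proof.
move=> S0 SD; pose p : {pred M} := fun x => `[< S x >].
have p_closed : submod_closed p.
  split=> [|a x y]; first exact/asboolP.
  by move=> /asboolP Sx /asboolP Sy; apply/asboolP; apply: SD.
pose F := GRing.isSubmodClosed.Build B M p p_closed.
pose T : submodClosed M := HB.pack p F.
by exists T => x; split=> [/asboolP|?]; [|apply/asboolP].
Qed.

Definition lcomp M N W (g : {linear N -> W}) (f : {linear M -> N}) :
  {linear M -> W} := g \o f.
Definition lsub M N (f g : {linear M -> N}) : {linear M -> N} := f \- g.

Lemma lcompE M N W (g : {linear N -> W}) (f : {linear M -> N}) x :
  lcomp g f x = g (f x).
Proof. by []. Qed.

Lemma lsubE M N (f g : {linear M -> N}) x : lsub f g x = f x - g x.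
Proof. by []. Qed.

(** Exactness at the middle term only; injectivity of [j] and surjectivity of [g] are assumed
    separately. Submodules thus appear as embeddings, which avoids nesting subtypes. *)
Definition exact K M N (j : {linear K -> M}) (g : {linear M -> N}) :=
  forall x, g x = 0 <-> exists y, j y = x.

Definition incl M (S : submodClosed M) : {linear submodule S -> M} := \val.

Lemma incl_inj M (S : submodClosed M) : injective (incl S).
Proof. exact: val_inj. Qed.

Lemma inclP M (S : submodClosed M) x : x \in S <-> exists y, incl S y = x.
Proof. by split=> [xS|[y <-]]; [exists (exist _ x xS) | apply: valP]. Qed.

Lemma injective_ker M N (f : {linear M -> N}) :
  (forall x, f x = 0 -> x = 0) -> injective f.
Proof.
move=> f0 x y fxy; apply/eqP; rewrite -subr_eq0; apply/eqP/f0.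
by rewrite linearB fxy subrr.
Qed.

Lemma ker_injective M N (f : {linear M -> N}) x : injective f -> f x = 0 -> x = 0.
Proof. by move=> f_inj fx; apply: f_inj; rewrite linear0. Qed.

Lemma ker_submod M N (f : {linear M -> N}) :
  exists S : submodClosed M, forall x, x \in S <-> f x = 0.
Proof.
apply: submod_bundle => [|a x y fx fy]; first exact: linear0.
by rewrite linearP fx fy scaler0 addr0.
Qed.

Lemma im_submod M N (f : {linear M -> N}) :
  exists S : submodClosed N, forall x, x \in S <-> exists y, f y = x.
Proof.
apply: submod_bundle => [|a _ _ [x <-] [y <-]]; first by exists 0; exact: linear0.
by exists (a *: x + y); rewrite linearP.
Qed.

Lemma kernel_exists M N (g : {linear M -> N}) :
  exists (K : lmodType B) (j : {linear K -> M}), injective j /\ exact j g.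
Proof.
have [S SP] := ker_submod g; exists (submodule S), (incl S).
by split=> [|x]; [exact: incl_inj | rewrite -SP; exact: inclP].
Qed.

Lemma cokernel_exists K M (j : {linear K -> M}) :
  exists (W : lmodType B) (q : {linear M -> W}), surjective_map q /\ exact j q.
Proof.
have [S SP] := im_submod j.
exists (quotient S), (@quot_proj _ _ S : {linear M -> quotient S}).
split=> [|x]; first exact: quot_proj_surj.
rewrite -SP -[x in x \in S]subr0 -(linear0 (@quot_proj _ _ S)).
by split=> /quot_projP.
Qed.

Lemma factor_surj M N W (q : {linear M -> N}) (f : {linear M -> W}) :
    surjective_map q -> (forall x, q x = 0 -> f x = 0) ->
  exists g : {linear N -> W}, forall x, g (q x) = f x.
Proof.
move=> /choice[s sK] qf.
have fq x y : q x = q y -> f x = f y.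
  move=> qxy; apply/eqP; rewrite -subr_eq0 -linearB; apply/eqP/qf.
  by rewrite linearB qxy subrr.
have [|g gE] := @linear_bundle N W (fun y => f (s y)).
  by move=> a x y; rewrite -linearP; apply: fq; rewrite linearP !sK.
by exists g => x; rewrite gE; apply: fq; rewrite sK.
Qed.

Lemma lift_inj M N W (j : {linear N -> M}) (f : {linear W -> M}) :
    injective j -> (forall x, exists y, j y = f x) ->
  exists g : {linear W -> N}, forall x, j (g x) = f x.
Proof.
move=> j_inj /choice[s sK].
have [|g gE] := @linear_bundle W N s.
  by move=> a x y; apply: j_inj; rewrite linearP !sK linearP.
by exists g => x; rewrite gE.
Qed.

Lemma inverse_exists M N (f : {linear M -> N}) :
    injective f -> surjective_map f ->
  exists g : {linear N -> M}, cancel f g /\ cancel g f.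
Proof.
move=> f_inj f_surj; have [//|g fgK] := @lift_inj _ _ _ f idfun f_inj.
by exists g; split=> // x; apply: f_inj; rewrite fgK.
Qed.

Lemma isomorphicP M N : isomorphic M N <->
  exists f : {linear M -> N}, injective f /\ surjective_map f.
Proof.
split=> [[f [g fK gK]]|[f [f_inj f_surj]]].
  by exists f; split=> [|y]; [apply: can_inj fK | exists (g y)].
by have [g [fK gK]] := inverse_exists f_inj f_surj; exists f, g.
Qed.

Lemma isomorphic_sym M N : isomorphic M N -> isomorphic N M.
Proof.
move=> /isomorphicP[f [f_inj f_surj]].
by have [g [fK gK]] := inverse_exists f_inj f_surj; exists g, f.
Qed.

Lemma surjective_comp M N W (g : {linear N -> W}) (f : {linear M -> N}) :
  surjective_map f -> surjective_map g -> surjective_map (lcomp g f).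
Proof. by move=> fs gs z; have [y <-] := gs z; have [x <-] := fs y; exists x. Qed.

Lemma fg_surj M N (f : {linear M -> N}) :
  surjective_map f -> finitely_generated M -> finitely_generated N.
Proof.
move=> f_surj [n [g gP]]; exists n, (f \o g) => y.
have [x <-] := f_surj y; have [a ->] := gP x; exists a.
by rewrite linear_sum; apply: eq_bigr => k _; rewrite linearZ.
Qed.

Lemma fg_zero M : (forall x : M, x = 0) -> finitely_generated M.
Proof. by move=> M0; exists 0%N, (fun=> 0) => x; exists (fun=> 0); rewrite big_ord0. Qed.

Lemma fg_ext K M N (j : {linear K -> M}) (g : {linear M -> N}) :
    surjective_map g -> exact j g ->
  finitely_generated K -> finitely_generated N -> finitely_generated M.
Proof.
move=> g_surj jg [m [u uP]] [n [v vP]].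
have /choice[w wP] : forall k, exists x, g x = v k by move=> k; apply: g_surj.
exists (m + n)%N, (fun k => match split k with inl l => j (u l) | inr l => w l end).
move=> x; have [b gx] := vP (g x).
have /jg[y] : g (x - \sum_(k < n) b k *: w k) = 0.
  rewrite linearB linear_sum gx; apply/eqP; rewrite subr_eq0; apply/eqP.
  by apply: eq_bigr => k _; rewrite linearZ /= wP.
have [a ->] := uP y => xE.
rewrite -[x](subrK (\sum_(k < n) b k *: w k)) -xE.
exists (fun k => match split k with inl l => a l | inr l => b l end).
rewrite big_split_ord linear_sum; congr (_ + _); apply: eq_bigr => k _.
  by rewrite (unsplitK (inl _)) linearZ.
by rewrite (unsplitK (inr _)).
Qed.

Lemma zero_or_nonzero M N (f : {linear M -> N}) :
  (forall x, f x = 0) \/ exists x, f x <> 0.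
Proof.
case: (EM (exists x, f x <> 0)) => [|/forallNP f0]; first by right.
by left=> x; apply: contrapT; exact: f0.
Qed.

Lemma simple_map_inj M N (f : {linear M -> N}) :
  simple_module M -> (exists x, f x <> 0) -> injective f.
Proof.
move=> [_ Msimple] [x fx]; have [S SP] := ker_submod f.
have [S0|S1] := Msimple S; last by case: fx; apply/SP.
by apply: injective_ker => y /SP/S0.
Qed.

Lemma simple_map_surj M N (f : {linear M -> N}) :
  simple_module N -> (exists x, f x <> 0) -> surjective_map f.
Proof.
move=> [_ Nsimple] [x fx]; have [S SP] := im_submod f.
have [S0|S1 y] := Nsimple S; last exact/SP.
by case: fx; apply/S0/SP; exists x.
Qed.

Lemma simple_nonzero M : simple_module M -> exists x : M, x <> 0.
Proof. by case=> -[x /eqP x0] _; exists x. Qed.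

Lemma simple_iso M N : isomorphic M N -> simple_module M -> simple_module N.
Proof.
move=> /isomorphicP[f [f_inj f_surj]] [[x x0] Msimple]; split.
  exists (f x); apply: contra_neq x0 => fx; exact: ker_injective fx.
move=> S; have [T TP] : exists T : submodClosed M, forall x, x \in T <-> f x \in S.
  apply: submod_bundle => [|a y z fy fz]; first by rewrite linear0 rpred0.
  by rewrite linearP rpredD // rpredZ.
have [T0|T1] := Msimple T; [left|right] => y; have [z <-] := f_surj y.
  by move=> /TP/T0 ->; rewrite linear0.
exact/TP.
Qed.

End Maps.
(* Keeps /= from unfolding to composite instances that no longer match the    *)
(* instances of [lcompE] and [lsubE].                                           *)
#[global] Opaque lcomp lsub.

(** * Filtrations *)

Section Filtrations.
Variables (B : pzRingType) (J : Type) (D : J -> lmodType B).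
Implicit Types (K M N W : lmodType B) (s : seq J).

(* The factors are listed from the top of the filtration to its bottom. *)
Fixpoint filtered s M : Prop :=
  if s is i :: s' then
    exists (K : lmodType B) (j : {linear K -> M}) (g : {linear M -> D i}),
      [/\ injective j, surjective_map g, exact j g & filtered s' K]
  else forall x : M, x = 0.

Lemma filtered_iso s M N : isomorphic M N -> filtered s M -> filtered s N.
Proof.
move=> /isomorphicP[f [f_inj f_surj]]; have [h [fK hK]] := inverse_exists f_inj f_surj.
case: s => [M0 y|i s [K [j [g [j_inj g_surj jg sK]]]]].
  by rewrite -(hK y) (M0 (h y)) linear0.
exists K, (lcomp f j), (lcomp g h); split=> //; first exact: inj_comp.
  by apply: surjective_comp => // y; exists (f y).
move=> y; split=> [/jg[z jz]|[z <-]]; first by exists z; rewrite lcompE jz hK.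
by rewrite !lcompE fK; apply/jg; exists z.
Qed.

Lemma filtered_fg s M :
  (forall i, finitely_generated (D i)) -> filtered s M -> finitely_generated M.
Proof.
move=> D_fg; elim: s M => [|i s IHs] M; first exact: fg_zero.
move=> [K [j [g [_ g_surj jg /IHs K_fg]]]].
exact: fg_ext g_surj jg K_fg (D_fg i).
Qed.

Lemma filtered_nonnil s M : filtered s M -> (exists x : M, x <> 0) -> s <> [::].
Proof. by move=> sM [x x0] s0; rewrite s0 in sM; apply/x0/sM. Qed.

(** [filtered] peels factors off the top, whereas later arguments need the lowest one. By induction
    [D b] sits at the bottom of [K], and [M / D b] is an extension of the top factor by
    [K / D b]. *)
Lemma filtered_bottom s M : filtered s M -> s <> [::] ->
  exists b t (W : lmodType B) (j : {linear D b -> M}) (q : {linear M -> W}),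
    [/\ injective j, surjective_map q, exact j q & filtered t W].
Proof.
elim: s M => // i s IHs M [K [j [g [j_inj g_surj jg sK]]]] _.
case: s IHs sK => [|a s] IHs sK.
  (* With a single factor, [K] is zero, so [g] is an isomorphism and its inverse is the embedding
     sought. *)
  have g_inj : injective g.
    by apply: injective_ker => x /jg[y <-]; rewrite (sK y) linear0.
  have [h [gK hK]] := inverse_exists g_inj g_surj.
  have [W [q [q_surj hq]]] := cokernel_exists h.
  exists i, [::], W, h, q; split=> //; first exact: can_inj hK.
  by move=> w; have [x <-] := q_surj w; apply/hq; exists (g x).
have [//|b [t [W0 [j0 [q0 [j0_inj q0_surj jq0 tW0]]]]]] := IHs K sK.
have [W [q [q_surj jq]]] := cokernel_exists (lcomp j j0).
have qj y : q (j y) = 0 <-> q0 y = 0.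
  split=> [/jq[z /j_inj<-]|/jq0[z <-]]; first by apply/jq0; exists z.
  by apply/jq; exists z.
have [|g' g'E] := @factor_surj _ _ _ _ q g q_surj.
  by move=> x /jq[z <-]; apply/jg; exists (j0 z).
have [|w wE] := @factor_surj _ _ _ _ q0 (lcomp q j) q0_surj.
  by move=> y /qj.
exists b, (i :: t), W, (lcomp j j0), q; split=> //; first exact: inj_comp.
exists W0, w, g'; split=> //.
- apply: injective_ker => u; have [y <-] := q0_surj u.
  by rewrite wE => /qj.
- by move=> y; have [x <-] := g_surj y; exists (q x).
move=> u; have [x <-] := q_surj u; rewrite g'E; split=> [/jg[y <-]|[v]].
  by exists (q0 y); rewrite wE.
have [y <-] := q0_surj v; rewrite wE lcompE => qjy.
by rewrite -g'E -qjy g'E; apply/jg; exists y.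
Qed.

End Filtrations.

Lemma filtered_map (B : pzRingType) (I J : Type) (D : J -> lmodType B)
    (c : I -> J) (s : seq I) (M : lmodType B) :
  filtered (fun k => D (c k)) s M -> filtered D (map c s) M.
Proof.
elim: s M => //= i s IHs M [K [j [g [j_inj g_surj jg /IHs sK]]]].
by exists K, j, g.
Qed.

(** The factors are labelled by the indices of the chain, so that the permutation statement keeps
    track of multiplicities. *)
Lemma filtered_of_filtration (B : pzRingType) (M : lmodType B) (n : nat)
    (X : 'I_n -> lmodType B) : has_filtration M X ->
  exists s : seq 'I_n, perm_eq s (enum 'I_n) /\ filtered X s M.
Proof.
move=> [F [F0 Fn FX]].
have chain k : (k <= n)%N -> exists s : seq 'I_n, [/\ uniq s,
    forall i : 'I_n, (i \in s) = (i < k)%N & filtered X s (submodule (F k))].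
  elim: k => [|k IHk] k_le.
    exists [::]; split=> // x; apply: (@incl_inj _ _ (F 0%N)); rewrite linear0.
    by apply/F0/inclP; exists x.
  have [s [s_uniq s_mem sF]] := IHk (ltnW k_le).
  exists (Ordinal k_le :: s); split.
  - by rewrite /= s_mem /= ltnn.
  - by move=> i; rewrite inE s_mem ltnS [in RHS]leq_eqVlt.
  have /= [Fsub /isomorphicP[f [f_inj f_surj]]] := FX (Ordinal k_le).
  have [|h hE] := @lift_inj _ _ _ _ (incl (F k.+1)) (incl (F k)) (@incl_inj _ _ _).
    by move=> x; apply/inclP/Fsub/inclP; exists x.
  pose q : {linear submodule (F k.+1) -> subquotient (F k.+1) (F k)} :=
    @quot_proj _ _ (restrict_pred (F k.+1) (F k) : submodClosed _).
  have qP x : q x = 0 <-> incl (F k.+1) x \in F k.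
    rewrite -[_ \in F k]/(x \in restrict_pred _ _) -[x in x \in _]subr0.
    by rewrite -(linear0 q); split=> /quot_projP.
  exists (submodule (F k)), h, (lcomp f q); split=> //.
  - by move=> x y /(congr1 (incl (F k.+1))); rewrite !hE => /incl_inj.
  - apply: surjective_comp => //; exact: quot_proj_surj.
  move=> x; rewrite lcompE; split=> [/(ker_injective f_inj)/qP/inclP[y yx]|[y yx]].
    by exists y; apply: incl_inj; rewrite hE.
  have /qP -> : incl (F k.+1) x \in F k.
    by rewrite -yx hE; apply/inclP; exists y.
  exact: linear0.
have [s [s_uniq s_mem sF]] := chain n (leqnn n).
exists s; split; last first.
  apply: filtered_iso sF; apply/isomorphicP; exists (incl (F n)).
  split=> [|x]; [exact: incl_inj | exact/inclP].
apply: uniq_perm => // [|i]; first exact: enum_uniq.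
by rewrite s_mem mem_enum ltn_ord.
Qed.

(** * Finite direct sums *)

Section Biproducts.
Variable B : pzRingType.
Implicit Types (K M N : lmodType B) (I : finType).

(** A direct sum decomposition given by coordinates. Joint injectivity of the projections replaces
    the usual sum identity, which [biproduct_sum] recovers. *)
Definition biproduct I (X : I -> lmodType B) M : Prop :=
  exists (f : forall k, {linear X k -> M}) (g : forall k, {linear M -> X k}),
    [/\ forall k x, g k (f k x) = x,
        forall k l x, k != l -> g l (f k x) = 0 &
        forall x, (forall k, g k x = 0) -> x = 0].

Lemma biproduct_sum I (X : I -> lmodType B) M
    (f : forall k, {linear X k -> M}) (g : forall k, {linear M -> X k}) :
    (forall k x, g k (f k x) = x) ->
    (forall k l x, k != l -> g l (f k x) = 0) ->
    (forall x, (forall k, g k x = 0) -> x = 0) ->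
  forall x, x = \sum_k f k (g k x).
Proof.
move=> gf1 gf0 g_inj x; apply/eqP; rewrite -subr_eq0; apply/eqP/g_inj => l.
rewrite linearB linear_sum (bigD1 l) //= gf1 big1 ?addr0 ?subrr // => k kl.
by rewrite gf0.
Qed.

Definition dsum_proj I (X : I -> lmodType B) k (u : direct_sum X) : X k :=
  (u : dsum_type X) k.

Fact dsum_proj_linear I (X : I -> lmodType B) k : linear (@dsum_proj I X k).
Proof. by move=> a u v; rewrite /dsum_proj !ffunE. Qed.
HB.instance Definition _ I (X : I -> lmodType B) k :=
  GRing.isLinear.Build B (direct_sum X) (X k) *:%R (@dsum_proj I X k)
    (@dsum_proj_linear I X k).

Definition dsum_inj I (X : I -> lmodType B) k (x : X k) : direct_sum X :=
  [ffun l => dfwith (fun l => 0 : X l) x l] : dsum_type X.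

Lemma dsum_injK I (X : I -> lmodType B) k (x : X k) : dsum_proj k (dsum_inj x) = x.
Proof. by rewrite /dsum_proj ffunE dfwith_in. Qed.

Lemma dsum_inj0 I (X : I -> lmodType B) k l (x : X k) :
  k != l -> dsum_proj l (dsum_inj x) = 0.
Proof. by move=> kl; rewrite /dsum_proj ffunE dfwith_out. Qed.

Lemma dsum_ext I (X : I -> lmodType B) (u v : direct_sum X) :
  (forall k, dsum_proj k u = dsum_proj k v) -> u = v.
Proof. by move=> uv; apply/ffunP. Qed.

Fact dsum_inj_linear I (X : I -> lmodType B) k : linear (@dsum_inj I X k).
Proof.
move=> a x y; apply: dsum_ext => l; rewrite linearP /=.
case: (eqVneq k l) => [<-|kl]; first by rewrite !dsum_injK.
by rewrite !dsum_inj0 // scaler0 addr0.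
Qed.
HB.instance Definition _ I (X : I -> lmodType B) k :=
  GRing.isLinear.Build B (X k) (direct_sum X) *:%R (@dsum_inj I X k)
    (@dsum_inj_linear I X k).

Lemma biproduct_direct_sum I (X : I -> lmodType B) : biproduct X (direct_sum X).
Proof.
exists (fun k => @dsum_inj I X k), (fun k => @dsum_proj I X k); split.
- exact: dsum_injK.
- by move=> k l x; exact: dsum_inj0.
by move=> x x0; apply: dsum_ext => k; rewrite x0 linear0.
Qed.

Lemma direct_sum_span I (X : I -> lmodType B) (u : direct_sum X) :
  u = \sum_k dsum_inj (dsum_proj k u).
Proof.
apply: (@biproduct_sum I X _ (fun k => @dsum_inj I X k) (fun k => @dsum_proj I X k)).
- exact: dsum_injK.
- by move=> k l x; exact: dsum_inj0.
by move=> x x0; apply: dsum_ext => k; rewrite x0 linear0.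
Qed.

Lemma biproduct_iso I (X : I -> lmodType B) M N :
  isomorphic M N -> biproduct X M -> biproduct X N.
Proof.
move=> /isomorphicP[h [h_inj h_surj]] [f [g [gf1 gf0 g_inj]]].
have [r [hK rK]] := inverse_exists h_inj h_surj.
exists (fun k => lcomp h (f k)), (fun k => lcomp (g k) r).
split=> [k x|k l x kl|x x0]; rewrite ?lcompE ?hK; [exact: gf1 | exact: gf0|].
by rewrite -(rK x) (g_inj (r x)) // linear0.
Qed.

Lemma biproductP I (X : I -> lmodType B) M :
  biproduct X M <-> isomorphic M (direct_sum X).
Proof.
split; last by move=> /isomorphic_sym /biproduct_iso; apply; exact: biproduct_direct_sum.
move=> [f [g [gf1 gf0 g_inj]]]; apply: isomorphic_sym; apply/isomorphicP.
pose h (u : direct_sum X) := \sum_k f k (dsum_proj k u).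
have h_lin : linear h.
  move=> a u v; rewrite /h scaler_sumr -big_split; apply: eq_bigr => k _.
  by rewrite !linearP.
have [h' h'E] := linear_bundle h_lin.
have gh u l : g l (h u) = dsum_proj l u.
  rewrite linear_sum (bigD1 l) //= gf1 big1 ?addr0 // => k kl.
  by rewrite gf0.
exists h'; split=> [|x].
  apply: injective_ker => u; rewrite h'E => u0; apply: dsum_ext => l.
  by rewrite -gh u0 !linear0.
exists (\sum_k dsum_inj (g k x)); rewrite h'E; apply/eqP; rewrite -subr_eq0.
apply/eqP/g_inj => l; rewrite linearB gh linear_sum (bigD1 l) //= dsum_injK.
by rewrite big1 ?addr0 ?subrr // => k kl; rewrite dsum_inj0.
Qed.

Lemma biproduct_reindex I I' (X : I -> lmodType B) (e : I' -> I) M :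
  bijective e -> biproduct X M -> biproduct (fun k => X (e k)) M.
Proof.
move=> [e' eK e'K] [f [g [gf1 gf0 g_inj]]].
exists (fun k => f (e k)), (fun k => g (e k)); split=> [k|k l x kl|x x0] //.
  by rewrite gf0 // (can_eq eK).
by apply: g_inj => k; rewrite -(e'K k).
Qed.

Lemma biproduct_zero M (X : void -> lmodType B) :
  (forall x : M, x = 0) -> biproduct X M.
Proof.
move=> M0; exists (fun k => match k : void return {linear X k -> M} with end).
exists (fun k => match k : void return {linear M -> X k} with end).
by split=> [[]|[]|x _].
Qed.

(** A split extension adds one summand, indexed by [None]; [r] is the idempotent [1 - s g] viewed as
    a map onto [K]. *)
Lemma biproduct_cons (J : Type) (D : J -> lmodType B) I (c : I -> J) a K M
    (j : {linear K -> M}) (g : {linear M -> D a}) (s : {linear D a -> M}) :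
    injective j -> exact j g -> (forall x, g (s x) = x) ->
    biproduct (fun k => D (c k)) K ->
  biproduct (fun o => D (oapp c a o)) M.
Proof.
move=> j_inj jg gs [f [h [hf1 hf0 h_inj]]].
have [|r rE] := @lift_inj _ _ _ _ j (lsub idfun (lcomp s g)) j_inj.
  by move=> x; apply/jg; rewrite lsubE lcompE linearB gs subrr.
have gj y : g (j y) = 0 by apply/jg; exists y.
have rj y : r (j y) = y by apply: j_inj; rewrite rE lsubE lcompE gj linear0 subr0.
have rs y : r (s y) = 0.
  by apply: j_inj; rewrite rE lsubE lcompE gs subrr linear0.
pose F (o : option I) : {linear D (oapp c a o) -> M} :=
  match o with Some k => lcomp j (f k) | None => s end.
pose G (o : option I) : {linear M -> D (oapp c a o)} :=
  match o with Some k => lcomp (h k) r | None => g end.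
exists F, G; split=> [[k|] x|[k|] [l|] x //|x x0] /=.
- by rewrite !lcompE rj hf1.
- exact: gs.
- by rewrite !lcompE rj => kl; rewrite hf0.
- by move=> _; exact: gj.
- by move=> _; rewrite lcompE rs linear0.
have gx : g x = 0 := x0 None.
have rx : r x = 0 by apply: h_inj => k; exact: (x0 (Some k)).
by have := rE x; rewrite rx lsubE lcompE gx !linear0 addr0.
Qed.

Lemma biproduct_filtered I (X : I -> lmodType B) M :
  biproduct X M -> filtered X (enum I) M.
Proof.
move=> [f [g [gf1 gf0 g_inj]]].
(* The identities are restricted to the indices of the list, so that the induction can drop the
   summands already split off. *)
have : forall x, (forall k, k \in enum I -> g k x = 0) -> x = 0.
  by move=> x x0; apply: g_inj => k; apply: x0; rewrite mem_enum.
have : forall k, k \in enum I -> forall x, g k (f k x) = x by [].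
have : forall k, k \in enum I -> forall l x, k != l -> g l (f k x) = 0.
  by move=> k _ l x; apply: gf0.
move=> {gf1 gf0 g_inj}; elim: (enum I) (enum_uniq I) M f g => [|k s IHs] s_uniq M f g.
  by move=> _ _ g_inj x; apply: g_inj.
move=> gf0 gf1 g_inj; have /andP[ks {}s_uniq] := s_uniq.
have [K [j [j_inj jg]]] := kernel_exists (g k).
have fK l : exists f' : {linear X l -> K}, l \in s -> forall x, j (f' x) = f l x.
  case: (boolP (l \in s)) => [ls|_]; last by exists \0.
  have [|f' f'E] := @lift_inj _ _ _ _ j (f l) j_inj; last by exists f'.
  move=> x; apply/jg; rewrite gf0 ?inE ?ls ?orbT //.
  by apply: contraNneq ks => <-.
exists K, j, (g k); split=> //; first by move=> x; exists (f k x); rewrite gf1 ?mem_head.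
apply: (IHs s_uniq K (fun l => projT1 (cid (fK l))) (fun l => lcomp (g l) j)).
- move=> l ls l' x ll'; rewrite lcompE; case: cid => f' /= /(_ ls) ->.
  by rewrite gf0 // inE ls orbT.
- by move=> l ls x; rewrite lcompE; case: cid => f' /= /(_ ls) ->; rewrite gf1 // inE ls orbT.
move=> y y0; apply: (ker_injective j_inj); apply: g_inj => l.
rewrite inE => /orP[/eqP->|/y0 //]; by apply/jg; exists y.
Qed.

(* S plays the role of the radical of Y j: a homomorphism from a summand is   *)
(* an isomorphism or not onto the top.                                        *)
Lemma biproduct_filtered_size I (X : I -> lmodType B) (J : Type)
    (Y : J -> lmodType B) (s : seq J) M :
    (forall k, exists x : X k, x <> 0) ->
    (forall j, exists S : submodClosed (Y j), ~ is_full_submod S /\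
       forall k (h : {linear X k -> Y j}),
         (injective h /\ surjective_map h) \/ forall x, h x \in S) ->
  biproduct X M -> filtered Y s M -> size s = #|I|.
Proof.
move=> X0 YS; elim: s I X X0 YS M => [|j s IHs] I X X0 YS M XM sM.
  have [f [g [gf1 _ _]]] := XM.
  symmetry; apply: eq_card0 => k; have [x x0] := X0 k.
  by case: x0; rewrite -(gf1 k x) (sM (f k x)) linear0.
have [f [g [gf1 gf0 g_inj]]] := XM.
have [K [i [h [i_inj h_surj ih sK]]]] := sM.
have [S [S_proper hS]] := YS j.
(* Otherwise [h] maps every summand, hence all of [M], into the proper submodule [S]. *)
have [k [hf_inj hf_surj]] : exists k,
    injective (lcomp h (f k)) /\ surjective_map (lcomp h (f k)).
  apply: contrapT => /forallNP nk; apply: S_proper => y.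
  have [x <-] := h_surj y; rewrite (biproduct_sum gf1 gf0 g_inj x) linear_sum.
  apply: rpred_sum => k _; have [/(nk k)//|] := hS k (lcomp h (f k)).
  by move=> /(_ (g k x)).
have [t [hfK tK]] := inverse_exists hf_inj hf_surj.
have hft y : h (f k (t y)) = y := tK y.
(* The other summands are moved into [K] by projecting along the image of [f k]. *)
have f'_ex l : exists f' : {linear X l -> K}, forall x,
    i (f' x) = f l x - f k (t (h (f l x))).
  apply: (@lift_inj _ _ _ _ i (lsub (f l) (lcomp (f k) (lcomp t (lcomp h (f l)))))) => //.
  by move=> x; apply/ih; rewrite lsubE !lcompE linearB hft subrr.
pose f' l := projT1 (cid (f'_ex l)).
have f'E l x : i (f' l x) = f l x - f k (t (h (f l x))).
  by rewrite /f'; case: cid.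
have size_s : size s = #|{: {l : I | l != k}}|.
  apply: (IHs _ (fun l => X (val l)) _ _ K) => //.
    by move=> j'; have [S' [? S'P]] := YS j'; exists S'; split.
  exists (fun l => f' (val l)), (fun l => lcomp (g (val l)) i); split.
  - move=> [l lk] x /=; rewrite lcompE f'E linearB gf1 gf0 1?eq_sym ?subr0 //.
  - move=> [l lk] [l' l'k] x; rewrite -val_eqE lcompE /= f'E => ll'.
    by rewrite linearB !gf0 ?subr0 // eq_sym.
  move=> y y0; have iy : i y = f k (g k (i y)).
    rewrite {1}(biproduct_sum gf1 gf0 g_inj (i y)) (bigD1 k) //= big1 ?addr0 //.
    move=> l lk; have := y0 (exist _ l lk); rewrite lcompE /= => ->.
    exact: linear0.
  apply: (ker_injective i_inj); rewrite iy (_ : g k (i y) = 0) ?linear0 //.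
  by apply: (ker_injective hf_inj); rewrite lcompE -iy; apply/ih; exists y.
rewrite /= size_s card_sig cardC1 prednK //; apply/card_gt0P; by exists k.
Qed.

End Biproducts.

(** * Numerical invariants, local modules, and induction over a finite poset *)

Lemma xget_neq0 (A : set nat) : xget 0%N A <> 0%N -> A (xget 0%N A).
Proof. by case: xgetP. Qed.

Lemma rad_of_local (B : pzRingType) (M : lmodType B) (R : submodClosed M) :
    ~ is_full_submod R ->
    (forall S : submodClosed M, is_full_submod S \/ {subset S <= R}) ->
  Rad M =i R.
Proof.
move=> R_proper R_max x; apply/idP/idP => [/asboolP|Rx].
  apply; split=> // T RT; have [T1|TR] := R_max T; first by right.
  by left.
apply/asboolP => S [S_proper S_max]; have [//|SR] := R_max S.
by have [|RS|] := S_max R; [exact: SR | exact: RS | move/R_proper].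
Qed.

Lemma finPOrder_ind (d : Order.disp_t) (T : finPOrderType d) (H : T -> Prop) :
  (forall i, (forall b, (b < i)%O -> H b) -> H i) -> forall i, H i.
Proof.
move=> Hrec i; have [n] := ubnP #|[pred b | (b < i)%O]|.
elim: n i => // n IHn i; rewrite ltnS => i_n; apply: Hrec => b bi.
apply: IHn; apply: leq_trans i_n; apply: proper_card; apply/properP; split.
  by apply/fintype.subsetP => a; rewrite !inE => /lt_trans; apply.
by exists b; rewrite !inE // ltxx.
Qed.

(** * Standard modules *)

Section Standard.
Variables (B : pzRingType) (d : Order.disp_t) (Phi : finPOrderType d).
Variables (L P : Phi -> lmodType B).
Hypotheses (L_simple : represents_simples L)
  (P_cover : forall i, is_projective_cover (P i) (L i))
  (Delta_mult1 : forall i, comp_mult (Delta P i) (L i) = 1%N).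
Implicit Types (i j a b : Phi) (M N X Y : lmodType B).
Local Notation D := (Delta P).

Definition Delta_proj i : {linear P i -> D i} :=
  @quot_proj _ _ (Tr (direct_sum (fun j : {j : Phi | ~~ (j <= i)%O} => P (val j))) (P i)).

Lemma Delta_proj_surj i : surjective_map (Delta_proj i).
Proof. exact: quot_proj_surj. Qed.

Lemma Delta_fg i : finitely_generated (D i).
Proof. by have [P_fg _ _] := P_cover i; apply: fg_surj (@Delta_proj_surj i) P_fg. Qed.

Lemma cover_top i : exists p : {linear P i -> L i}, surjective_map p /\
  forall S : submodClosed (P i), is_full_submod S \/ forall x, x \in S -> p x = 0.
Proof.
have [_ _ [p p_surj p_sup]] := P_cover i; exists p; split=> // S.
have [pS0|[x pSx]] := zero_or_nonzero (lcomp p (incl S)).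
  by right=> _ /inclP[y <-]; apply: pS0.
have pS_surj : surjective_map (lcomp p (incl S)).
  by apply: simple_map_surj; [case: L_simple | exists x].
left; apply: p_sup => y; have [z zy] := pS_surj (p y).
exists (incl S z); first by apply/inclP; exists z.
by rewrite linearB -zy lcompE subrr.
Qed.

(** The kernel of [f] is proper, hence contained in that of the top map [p]; the induced nonzero map
    between simple modules is an isomorphism. *)
Lemma cover_quotient_iso i Y (f : {linear P i -> Y}) :
  simple_module Y -> (exists x, f x <> 0) -> isomorphic Y (L i).
Proof.
move=> Y_simple fx0; have f_surj := simple_map_surj Y_simple fx0.
have [p [p_surj p_max]] := cover_top i; have [S SP] := ker_submod f.
have pf x : f x = 0 -> p x = 0.
  have [S1|Sp] := p_max S; last by move/SP/Sp.
  by have [y []] := fx0; apply/SP.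
have [h hE] := factor_surj f_surj pf.
have [Ls _ _] := L_simple.
have [y y0] := simple_nonzero (Ls i); have [x px] := p_surj y.
have hx0 : exists x, h x <> 0 by exists (f x); rewrite hE px.
by apply/isomorphicP; exists h; split; [apply: simple_map_inj | apply: simple_map_surj].
Qed.

(** Descend along the series until the induced map to the top factor is nonzero; that factor is then
    [L i]. *)
Lemma count_simple_factors n (X : 'I_n -> lmodType B) (s : seq 'I_n) i M
    (g : {linear P i -> M}) :
    (forall k, simple_module (X k)) -> filtered X s M -> (exists x, g x <> 0) ->
  has (fun k => `[< isomorphic (X k) (L i) >]) s.
Proof.
move=> X_simple; elim: s M g => [|k s IHs] M g /=.
  by move=> M0 [x []].
move=> [K [j [h [j_inj _ jh sK]]]] [x gx].
have [hg0|hg] := zero_or_nonzero (lcomp h g); last first.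
  by apply/orP; left; apply/asboolP; exact: cover_quotient_iso hg.
have [|g' g'E] := @lift_inj _ _ _ _ j g j_inj.
  by move=> y; apply/jh; rewrite -lcompE.
apply/orP; right; apply: (IHs K g' sK).
by exists x => g'x; apply: gx; rewrite -g'E g'x linear0.
Qed.

(** The multiplicity [1] differs from the default value of [xget], so it comes from an actual
    composition series. *)
Lemma Delta_composition_series i :
  exists n (X : 'I_n -> lmodType B) (s : seq 'I_n),
    [/\ forall k, simple_module (X k), filtered X s (D i) &
        count (fun k => `[< isomorphic (X k) (L i) >]) s = 1%N].
Proof.
have : exists (n : nat) (X : 'I_n -> lmodType B),
    [/\ forall k, simple_module (X k), has_filtration (D i) X &
        comp_mult (D i) (L i) = #|[set k : 'I_n | `[< isomorphic (X k) (L i) >]]|].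
  have c0 : comp_mult (D i) (L i) <> 0%N by rewrite Delta_mult1.
  exact (xget_neq0 c0).
rewrite Delta_mult1 => -[n [X [X_simple /filtered_of_filtration[s [s_perm sD]] card1]]].
exists n, X, s; split=> //; rewrite (permP s_perm) card1.
by rewrite -sum1_count big_enum_cond -sum1_card; apply: eq_bigl => k; rewrite inE.
Qed.

Lemma Delta_nonzero i : exists x : D i, x <> 0.
Proof.
have [n [X [[|k s] [X_simple sD //= _]]]] := Delta_composition_series i.
case: sD => K [j [g [_ g_surj _ _]]].
have [y y0] := simple_nonzero (X_simple k); have [x gx] := g_surj y.
by exists x => x0; apply: y0; rewrite -gx x0 linear0.
Qed.

(** As [D i] is nonzero, the kernel of [Delta_proj i] is proper and lies in that of the top map of
    [P i]. The local structure of [P i] therefore descends to [D i]. *)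
Lemma Delta_top i : exists q : {linear D i -> L i},
  [/\ surjective_map q, forall x, q x = 0 <-> x \in Rad (D i),
      ~ is_full_submod (Rad (D i)) &
      forall S : submodClosed (D i), is_full_submod S \/ {subset S <= Rad (D i)}].
Proof.
have [p [p_surj p_max]] := cover_top i; set pi := Delta_proj i.
have [T TP] := ker_submod pi.
have [|q qE] := factor_surj (@Delta_proj_surj i) (f := p).
  move=> x /TP Tx; have [T1|Tp] := p_max T; last exact: Tp.
  have [y []] := Delta_nonzero i; have [z <-] := Delta_proj_surj y.
  exact/TP.
have q_surj : surjective_map q by move=> y; have [x <-] := p_surj y; exists (pi x).
have [R RP] := ker_submod q.
have q_max (S : submodClosed (D i)) : is_full_submod S \/ {subset S <= R}.
  have [T' T'P] : exists T', forall x, x \in (T' : submodClosed (P i)) <-> pi x \in S.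
    apply: submod_bundle => [|a x y Sx Sy]; first by rewrite linear0 rpred0.
    by rewrite linearP rpredD // rpredZ.
  have [T1|T'p] := p_max T'; [left|right] => y; have [x <-] := Delta_proj_surj y.
    exact/T'P.
  by move=> Sx; apply/RP; rewrite qE; apply: T'p; apply/T'P.
have R_proper : ~ is_full_submod R.
  move=> R1; have [Ls _ _] := L_simple; have [y []] := simple_nonzero (Ls i).
  by have [x <-] := q_surj y; apply/RP.
have radR := rad_of_local R_proper q_max.
exists q; split=> //.
- by move=> x; rewrite radR; split=> [/RP|/RP].
- by move=> rad1; apply: R_proper => x; rewrite -radR.
by move=> S; have [S1|SR] := q_max S; [left | right=> x; rewrite radR; apply: SR].
Qed.

(** * Homomorphisms from projective covers to standard modules *)

Lemma map_to_Delta i X (h : {linear X -> D i}) :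
  surjective_map h \/ forall x, h x \in Rad (D i).
Proof.
have [q [_ _ _ rad_max]] := Delta_top i; have [S SP] := im_submod h.
have [S1|SR] := rad_max S; [left=> y; exact/SP | right=> x].
by apply/SR/SP; exists x.
Qed.

Lemma cover_Delta_eq a b (f : {linear P a -> D b}) : surjective_map f -> a = b.
Proof.
move=> f_surj; have [q [q_surj _ _ _]] := Delta_top b.
have [Ls L_inj _] := L_simple; apply/esym/L_inj.
have qf_surj := surjective_comp f_surj q_surj.
apply: (cover_quotient_iso (Ls b) (f := lcomp q f)).
have [y y0] := simple_nonzero (Ls b); have [x xy] := qf_surj y.
by exists x; rewrite xy.
Qed.

Lemma Delta_Delta_eq a b (f : {linear D a -> D b}) : surjective_map f -> a = b.
Proof. by move/(surjective_comp (@Delta_proj_surj a))/cover_Delta_eq. Qed.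

(** By projectivity [f] lifts to [P a], and the image of the lift lies in the trace that is factored
    out in [D a]. *)
Lemma cover_Delta_zero j a (f : {linear P j -> D a}) :
  ~~ (j <= a)%O -> forall x, f x = 0.
Proof.
move=> ja x; have [P_fg P_proj _] := P_cover j; have [Pa_fg _ _] := P_cover a.
have [h hE] := P_proj _ _ _ f Pa_fg (Delta_fg a) (@Delta_proj_surj a).
rewrite -hE -[h x]subr0 linearB; apply/eqP; rewrite subr_eq0; apply/eqP.
apply/quot_projP; rewrite subr0; apply/asboolP.
pose V (k : {j : Phi | ~~ (j <= a)%O}) := P (val k).
pose k : {j : Phi | ~~ (j <= a)%O} := exist _ j ja.
exists [:: h x]; last by rewrite big_seq1.
move=> z; rewrite inE => /eqP->.
exists (lcomp h (@dsum_proj B _ V k : {linear direct_sum V -> V k})).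
exists (@dsum_inj B _ V k x).
by rewrite lcompE /= dsum_injK.
Qed.

(** The trace is spanned by images of maps [P j -> P a], so only maps to [X] that factor through [f]
    have to vanish. [cogenerated_semisimple] relies on this restriction. *)
Lemma factor_Delta a X (f : {linear P a -> X}) :
    (forall j (h : {linear P j -> X}), ~~ (j <= a)%O ->
       (exists h' : {linear P j -> P a}, forall x, f (h' x) = h x) -> forall x, h x = 0) ->
  exists g : {linear D a -> X}, forall x, g (Delta_proj a x) = f x.
Proof.
move=> hom0; apply: (factor_surj (@Delta_proj_surj a)) => x.
rewrite -(linear0 (Delta_proj a)) => /quot_projP; rewrite subr0 => /asboolP[s sP ->].
rewrite linear_sum big_seq big1 // => z /sP[h [u ->]].
rewrite (direct_sum_span u) !linear_sum big1 // => k _ /=.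
apply: (hom0 _ (lcomp f (lcomp h (@dsum_inj _ _ _ k))) (valP k)).
by eexists.
Qed.

Lemma cover_map_Delta a (f : {linear P a -> D a}) :
  exists g : {linear D a -> D a}, forall x, g (Delta_proj a x) = f x.
Proof. by apply: factor_Delta => j h ja _; apply: cover_Delta_zero. Qed.

(** Lifting [Delta_proj i] along [f] and descending to [D i] gives [g] with [f g = 1]. The kernel of
    [f] lies in the radical, so [g] cannot have image in the radical; hence [g] is onto and [f] is
    its inverse. *)
Lemma Delta_endo_inj i (f : {linear D i -> D i}) : surjective_map f -> injective f.
Proof.
move=> f_surj; have [_ P_proj _] := P_cover i.
have [h hE] := P_proj _ _ f (Delta_proj i) (Delta_fg i) (Delta_fg i) f_surj.
have [g gE] := cover_map_Delta h.
have fg x : f (g x) = x by have [y <-] := Delta_proj_surj x; rewrite gE hE.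
have g_surj : surjective_map g.
  have [//|gR] := map_to_Delta g.
  have [q [_ qR R_proper rad_max]] := Delta_top i.
  case: R_proper => x; rewrite -(subrK (g (f x)) x) rpredD //.
  have [S SP] := ker_submod f; have [S1|SR] := rad_max S.
    have [y []] := Delta_nonzero i; rewrite -(fg y); exact/SP.
  by apply/SR/SP; rewrite linearB fg subrr.
by apply: injective_ker => x; have [y <-] := g_surj x; rewrite fg => ->; rewrite linear0.
Qed.

(** The single composition factor [L i] of [D i] is its top. A nonzero map from [P i] into the
    radical would produce a second one below it. *)
Lemma cover_map_rad_zero i (g : {linear P i -> D i}) :
  (forall x, g x \in Rad (D i)) -> forall x, g x = 0.
Proof.
move=> gR x; have [//|g0] := zero_or_nonzero g.
have [n [X [[|k s] [X_simple sD //= s1]]]] := Delta_composition_series i.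
case: sD => K [j [v [j_inj v_surj jv sK]]].
have [w [w0 vw]] : exists w, w <> 0 /\ exists x, v x = w.
  have [w w0] := simple_nonzero (X_simple k); exists w; split=> //; exact: v_surj.
have kL : isomorphic (X k) (L i).
  apply: (@cover_quotient_iso _ _ (lcomp v (Delta_proj i))) => //.
  case: vw => z vz; have [y yz] := Delta_proj_surj z; exists y.
  by rewrite lcompE yz vz.
have vg y : v (g y) = 0.
  have [q [q_surj qR R_proper rad_max]] := Delta_top i.
  (* Otherwise [v] maps the radical onto the simple module [X k]; then [D i] is the sum of the
     radical and the kernel of [v], which also lies in the radical. *)
  suff vR u : u \in Rad (D i) -> v u = 0 by apply: vR.
  move=> Ru; have [v0|[u' vu']] := zero_or_nonzero (lcomp v (incl (Rad (D i)))).
    by have /inclP[y' <-] := Ru; exact: v0.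
  have vR_surj : surjective_map (lcomp v (incl (Rad (D i)))).
    by apply: simple_map_surj => //; exists u'.
  case: R_proper => z; have [z' z'E] := vR_surj (v z).
  rewrite -(subrK (incl _ z') z) rpredD //; last by apply/inclP; exists z'.
  have [S SP] := ker_submod v; have [S1|SR] := rad_max S.
    by case: w0; case: vw => y' <-; apply/SP.
  by apply/SR/SP; rewrite linearB -z'E lcompE subrr.
have [|g' g'E] := @lift_inj _ _ _ _ j g j_inj; first by move=> y; apply/jv.
have : has (fun k => `[< isomorphic (X k) (L i) >]) s.
  apply: (@count_simple_factors _ _ _ _ _ g') sK _ => //.
  by have [y gy] := g0; exists y => g'y; apply: gy; rewrite -g'E g'y linear0.
by move: s1; rewrite has_count; case: asboolP => // _; rewrite add1n => -[->].
Qed.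

(** Supplies the descent in [Phi] on which the inductions over labels rest. *)
Lemma cover_map_rad_lt b i (g : {linear P b -> D i}) :
  (forall x, g x \in Rad (D i)) -> (exists x, g x <> 0) -> (b < i)%O.
Proof.
move=> gR [x gx]; rewrite lt_neqAle; apply/andP; split.
  apply/eqP => bi; subst i; apply: gx; exact: cover_map_rad_zero.
apply: contrapT => /negP bi; apply: gx; exact: cover_Delta_zero.
Qed.

(** * Right ultra strongly quasihereditary algebras *)

Variable Q : Phi -> lmodType B.
Hypotheses (Q_hull : forall i, is_injective_hull (Q i) (L i))
  (Rad_F : forall i, in_F_Delta P (submodule (Rad (D i))))
  (Q_F : forall i, is_zero_submod (Rad (D i)) -> in_F_Delta P (Q i)).
Implicit Types (s : seq Phi) (K W : lmodType B) (m t : Phi).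

Lemma Delta_filtration_filtered n (c : 'I_n -> Phi) M :
  Delta_filtration P M c -> exists s, size s = n /\ filtered D s M.
Proof.
move=> /filtered_of_filtration[s [s_perm sM]]; exists (map c s); split.
  by rewrite size_map (perm_size s_perm) size_enum_ord.
exact: filtered_map.
Qed.

Lemma in_F_filtered M : in_F_Delta P M -> exists s, filtered D s M.
Proof.
by move=> [n [c /Delta_filtration_filtered[s [_ sM]]]]; exists s.
Qed.

Lemma Rad_filtered i : exists s, filtered D s (submodule (Rad (D i))).
Proof. exact: in_F_filtered. Qed.

Lemma hull_filtered t :
  is_zero_submod (Rad (D t)) -> exists s, filtered D s (Q t).
Proof. by move/Q_F/in_F_filtered. Qed.

(** * Homomorphisms from standard modules to $\Delta$-filtered modules *)

Lemma filtered_factor_lt s M b i (u : {linear M -> D i}) :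
    filtered D s M -> b \in s -> injective u ->
  (forall x, u x \in Rad (D i)) -> (b < i)%O.
Proof.
elim: s M u => // a s IHs M u sM.
have M_fg := filtered_fg Delta_fg sM.
case: sM => K [j [g [j_inj g_surj jg sK]]].
rewrite inE => /orP[/eqP->|bs] u_inj uR; last first.
  apply: (IHs K (lcomp u j)) => //; first exact: inj_comp.
  by move=> x; rewrite lcompE.
have [_ Pa_proj _] := P_cover a.
have [h hE] := Pa_proj _ _ g (Delta_proj a) M_fg (Delta_fg a) g_surj.
apply: (cover_map_rad_lt (g := lcomp u h)).
  by move=> x; rewrite lcompE.
have [x x0] := Delta_nonzero a.
have [y yx] := Delta_proj_surj x; exists y; rewrite lcompE => /(ker_injective u_inj) hy.
by apply: x0; rewrite -yx -hE hy linear0.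
Qed.

(** Induction on [l]. A surjection forces [i = l]. Any other map lands in the radical, which by (A1)
    is filtered by standard modules with smaller labels; the induction hypothesis applies at the
    first factor where the map is nonzero. *)
Lemma Delta_map_inj i l (f : {linear D i -> D l}) :
  (exists x, f x <> 0) -> injective f.
Proof.
move: i f; elim/finPOrder_ind: l => l IHl i f [x fx].
have [f_surj|fR] := map_to_Delta f.
  have il := Delta_Delta_eq f_surj.
  by subst i; apply: (Delta_endo_inj).
have [|f' f'E] := @lift_inj _ _ _ _ (incl (Rad (D l))) f (@incl_inj _ _ _).
  by move=> y; apply/inclP.
have [s sR] := Rad_filtered l.
suff f'_inj : injective f'.
  by move=> y z; rewrite -!f'E => /incl_inj/f'_inj.
have f'x : f' x <> 0 by move=> f'x; apply: fx; rewrite -f'E f'x linear0.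
have s_lt b : b \in s -> (b < l)%O.
  move=> bs; apply: (filtered_factor_lt sR bs (u := incl _) (@incl_inj _ _ _)).
  by move=> y; apply/inclP; exists y.
(* The radical is generalised to any module filtered by labels below [l], as its kernels of
   projections are needed. *)
clear f'E; elim: s (submodule (Rad (D l))) sR s_lt f' f'x => [|b s IHs] M.
  by move=> M0 _ f' []; apply: M0.
move=> [K [j [g [j_inj _ jg sK]]]] s_lt f' f'x.
have [gf0|gf] := zero_or_nonzero (lcomp g f'); last first.
  have := IHl b (s_lt b (mem_head _ _)) i (lcomp g f') gf.
  by move=> gf_inj y z yz; apply: gf_inj; rewrite !lcompE yz.
have [|h hE] := @lift_inj _ _ _ _ j f' j_inj.
  by move=> y; apply/jg; rewrite -lcompE.
suff h_inj : injective h by move=> y z; rewrite -!hE => /j_inj/h_inj.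
apply: (IHs K sK) => [b' b's|hx]; first by apply: s_lt; rewrite inE b's orbT.
by apply: f'x; rewrite -hE hx linear0.
Qed.

Lemma Delta_filtered_inj i s M (f : {linear D i -> M}) :
  filtered D s M -> (exists x, f x <> 0) -> injective f.
Proof.
elim: s M f => [|b s IHs] M f; first by move=> M0 [x []]; apply: M0.
move=> [K [j [g [j_inj _ jg sK]]]] [x fx].
have [gf0|gf] := zero_or_nonzero (lcomp g f); last first.
  move=> y z yz; apply: (Delta_map_inj gf); by rewrite !lcompE yz.
have [|h hE] := @lift_inj _ _ _ _ j f j_inj.
  by move=> y; apply/jg; rewrite -lcompE.
suff h_inj : injective h by move=> y z; rewrite -!hE => /j_inj/h_inj.
by apply: (IHs K) => //; exists x => hx; apply: fx; rewrite -hE hx linear0.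
Qed.

(** Pass to a bottom factor, then to the bottom factor of its radical, and so on; the labels
    decrease until the radical vanishes. (A2) applies to the label reached. *)
Lemma Delta_in_filtered s M : filtered D s M -> (exists x : M, x <> 0) ->
  exists t (v : {linear D t -> M}), injective v /\ is_zero_submod (Rad (D t)).
Proof.
have Delta_case l :
    exists t (v : {linear D t -> D l}), injective v /\ is_zero_submod (Rad (D t)).
  elim/finPOrder_ind: l => l IHl.
  have [Rad0|/existsNP[x /not_implyP[xR x0]]] := EM (is_zero_submod (Rad (D l))).
    by exists l, idfun; split=> // y z.
  have [s' sR] := Rad_filtered l; have [z zx] := (inclP _ _).1 xR.
  have [|b [r [W [j [q [j_inj _ _ _]]]]]] := filtered_bottom sR.
    apply: (filtered_nonnil sR); exists z => z0.
    by apply: x0; rewrite -zx z0 linear0.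
  have [|t [v [v_inj t0]]] := IHl b.
    apply: (cover_map_rad_lt (g := lcomp (incl _) (lcomp j (Delta_proj b)))).
      by move=> y; rewrite lcompE; apply/inclP; eexists.
    have [y y0] := Delta_nonzero b; have [u uy] := Delta_proj_surj y.
    exists u; rewrite !lcompE uy => /(ker_injective (@incl_inj _ _ _)).
    by move/(ker_injective j_inj).
  exists t, (lcomp (incl _) (lcomp j v)); split=> //.
  by apply: inj_comp; [apply: incl_inj | apply: inj_comp].
move=> sM M0; have s0 := filtered_nonnil sM M0.
have [b [r [W [j [q [j_inj _ _ _]]]]]] := filtered_bottom sM s0.
have [t [v [v_inj t0]]] := Delta_case b.
by exists t, (lcomp j v); split=> //; apply: inj_comp.
Qed.

(** * Simple standard modules, their injective hulls, and radicals *)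

Lemma simple_Delta t : is_zero_submod (Rad (D t)) -> isomorphic (D t) (L t).
Proof.
move=> Rad0; have [q [q_surj qR _ _]] := Delta_top t.
apply/isomorphicP; exists q; split=> //; apply: injective_ker => x.
by move/qR/Rad0.
Qed.

Lemma simple_Delta_simple t : is_zero_submod (Rad (D t)) -> simple_module (D t).
Proof.
move/simple_Delta/isomorphic_sym/simple_iso; apply.
by have [Ls _ _] := L_simple.
Qed.

(** By essentiality a nonzero submodule of [Q t] meets the image of [L t] nontrivially, and by
    simplicity it contains that image. *)
Lemma simple_Delta_hull t : is_zero_submod (Rad (D t)) ->
  exists e : {linear D t -> Q t}, injective e /\
    forall S : submodClosed (Q t), (exists2 x, x \in S & x <> 0) ->
      forall y, e y \in S.
Proof.
move=> t0; have /isomorphicP[q [q_inj _]] := simple_Delta t0.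
have [_ _ [e e_inj e_ess]] := Q_hull t.
exists (lcomp e q); split=> [|S [x xS x0] y]; first exact: inj_comp.
have [T TP] : exists T : submodClosed (L t), forall z, z \in T <-> e z \in S.
  apply: submod_bundle => [|a u v eu ev]; first by rewrite linear0 rpred0.
  by rewrite linearP rpredD // rpredZ.
have [Ls _ _] := L_simple; have [_ Lt_simple] := Ls t.
have [T0|T1] := Lt_simple T; last by rewrite lcompE; apply/TP.
case: x0; apply: (e_ess S) => // z /TP/T0 ->; exact: linear0.
Qed.

Lemma Rad_Delta i : is_zero_submod (Rad (D i)) \/
  exists b (j : {linear D b -> D i}),
    [/\ (b < i)%O, injective j & forall x, x \in Rad (D i) <-> exists y, j y = x].
Proof.
have [|/existsNP[x /not_implyP[xR x0]]] := EM (is_zero_submod (Rad (D i))); first by left.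
right; have [s sR] := Rad_filtered i; have [z zx] := (inclP _ _).1 xR.
have [|b [r [W [j [q [j_inj q_surj jq rW]]]]]] := filtered_bottom sR.
  apply: (filtered_nonnil sR); exists z => z0.
  by apply: x0; rewrite -zx z0 linear0.
pose u := lcomp (incl (Rad (D i))) j.
have u_inj : injective u by apply: inj_comp => //; apply: incl_inj.
have uR y : u y \in Rad (D i) by apply/inclP; exists (j y); rewrite lcompE.
have bi : (b < i)%O.
  apply: (cover_map_rad_lt (g := lcomp u (Delta_proj b))) => [y|].
    by rewrite lcompE.
  have [y y0] := Delta_nonzero b; have [v vy] := Delta_proj_surj y.
  by exists v; rewrite lcompE vy => /(ker_injective u_inj).
exists b, u; split=> // y; split=> [/inclP[v vy]|[v <-]//].
(* Otherwise a simple standard submodule D t of Rad (D i) / D b yields, by    *)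
(* extending D t -> Q t, a nonzero non-injective homomorphism D i -> Q t.     *)
suff W0 (w : W) : w = 0.
  have /jq[y' jy'] : q v = 0 by apply: W0.
  by exists y'; rewrite lcompE jy'.
apply: contrapT => w0.
have [|t [f [f_inj t0]]] := Delta_in_filtered rW; first by exists w.
have [e [e_inj _]] := simple_Delta_hull t0.
have [Z [c [c_surj uc]]] := cokernel_exists u.
(* [k] embeds [W], which is [Rad (D i) / D b], into [Z], which is [D i / D b]; so [e] extends along
   [lcomp k f] to [Z]. *)
have [|k kE] := factor_surj q_surj (f := lcomp c (incl (Rad (D i)))).
  by move=> y' /jq[y'' <-]; rewrite lcompE; apply/uc; exists y''; rewrite lcompE.
have k_inj : injective k.
  apply: injective_ker => w'; have [y' <-] := q_surj w'.
  rewrite kE lcompE => /uc[y'']; rewrite lcompE => /incl_inj jy'.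
  by apply/jq; exists y''.
have [_ Q_inj _] := Q_hull t.
have [|h hE] := Q_inj _ _ (lcomp k f) e (Delta_fg t) (fg_surj c_surj (Delta_fg i)).
  exact: inj_comp.
have [s' sQ] := hull_filtered t0.
have hc0 : exists x', lcomp h c x' <> 0.
  have [y' y'0] := Delta_nonzero t; have [x' cx'] := c_surj (k (f y')).
  exists x'; rewrite lcompE cx' -[k _]lcompE hE => /(ker_injective e_inj).
  exact: y'0.
have [y' y'0] := Delta_nonzero b; apply: y'0.
apply: (ker_injective u_inj); apply: (ker_injective (Delta_filtered_inj sQ hc0)).
rewrite lcompE (_ : c _ = 0) ?linear0 //.
by apply/uc; exists y'.
Qed.

(** * Submodules and socles of standard modules *)

Lemma Delta_submodule i X (u : {linear X -> D i}) :
    injective u -> (exists x : X, x <> 0) ->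
  exists a (v : {linear D a -> X}), injective v /\ surjective_map v.
Proof.
move: X u; elim/finPOrder_ind: i => i IHi X u u_inj [x x0].
have [u_surj|uR] := map_to_Delta u.
  have [v [uK vK]] := inverse_exists u_inj u_surj.
  exists i, v; split; first exact: can_inj vK.
  by move=> y; exists (u y).
have [Rad0|[b [j [bi j_inj jR]]]] := Rad_Delta i.
  by case: x0; apply: (ker_injective u_inj); apply: Rad0.
have [|u' u'E] := @lift_inj _ _ _ _ j u j_inj; first by move=> y; apply/jR.
apply: (IHi b bi X u'); last by exists x.
by move=> y z yz; apply: u_inj; rewrite -!u'E yz.
Qed.

(** A nonzero submodule is everything or lies in the radical, which is standard with a smaller
    label. The last clause puts the image of [sigma] inside every nonzero submodule, making it the
    simple essential socle. *)
Lemma Delta_socle i : exists t (sigma : {linear D t -> D i}),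
  [/\ is_zero_submod (Rad (D t)), injective sigma &
      forall X (u : {linear X -> D i}), injective u -> (exists x : X, x <> 0) ->
        exists v : {linear D t -> X}, forall x, u (v x) = sigma x].
Proof.
elim/finPOrder_ind: i => i IHi.
have [Rad0|[b [j [bi j_inj jR]]]] := Rad_Delta i.
  exists i, idfun; split=> // X u u_inj [x x0].
  have [u_surj|uR] := map_to_Delta u; first exact: lift_inj.
  by case: x0; apply: (ker_injective u_inj); apply: Rad0.
have [t [sigma [t0 sigma_inj sigmaP]]] := IHi b bi.
exists t, (lcomp j sigma); split=> // [|X u u_inj [x x0]]; first exact: inj_comp.
have [u_surj|uR] := map_to_Delta u; first exact: lift_inj.
have [|u' u'E] := @lift_inj _ _ _ _ j u j_inj; first by move=> y; apply/jR.
have [||v vE] := sigmaP X u'; last by exists v => y; rewrite -u'E vE lcompE.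
  by move=> y z yz; apply: u_inj; rewrite -!u'E yz.
by exists x.
Qed.

(** The image of a nonzero [f] is some standard module [D b], and a surjection from [P a] onto it
    forces [a = b]. *)
Lemma cover_map_factor a l (f : {linear P a -> D l}) :
  exists g : {linear D a -> D l}, forall x, g (Delta_proj a x) = f x.
Proof.
have [f0|[x fx]] := zero_or_nonzero f; first by exists \0 => x; rewrite f0.
have [S SP] := im_submod f.
have [z zx] : exists z, incl S z = f x by apply/inclP/SP; exists x.
have [|b [v [v_inj v_surj]]] := Delta_submodule (@incl_inj _ _ S).
  by exists z => z0; apply: fx; rewrite -zx z0 linear0.
have iv_inj : injective (lcomp (incl S) v).
  by apply: inj_comp => //; apply: incl_inj.
have [|h hE] := @lift_inj _ _ _ _ (lcomp (incl S) v) f iv_inj.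
  move=> y; have /inclP[y' y'E] : f y \in S by apply/SP; exists y.
  by have [w vw] := v_surj y'; exists w; rewrite lcompE vw.
have h_surj : surjective_map h.
  move=> w; have /SP[y yE] : incl S (v w) \in S by apply/inclP; eexists.
  by exists y; apply: iv_inj; rewrite hE yE lcompE.
have ab := cover_Delta_eq h_surj; subst b.
have [g gE] := cover_map_Delta h.
by exists (lcomp (incl S) (lcomp v g)) => y; rewrite !lcompE gE -hE lcompE.
Qed.

(** * $\Delta$-semisimple modules: cogeneration and extensions *)

(** Arbitrary finite index types, so that a summand can be added by passing to [option]. *)
Definition semisimple M : Prop :=
  exists (I : finType) (c : I -> Phi), biproduct (fun k => D (c k)) M.

Lemma semisimpleP M : semisimple M <-> Delta_semisimple P M.
Proof.
split=> [[I [c Mc]]|[n [c /biproductP Mc]]]; last by exists 'I_n, c.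
exists #|I|, (fun k => c (enum_val k)); apply/biproductP.
exact: (biproduct_reindex (@enum_val_bij I)) Mc.
Qed.

Lemma semisimple_fg M : semisimple M -> finitely_generated M.
Proof. by move=> [I [c /biproduct_filtered/filtered_fg]]; apply=> k; apply: Delta_fg. Qed.

(* A projective cover P a -> D a of the image of one of the maps lifts to N;  *)
(* as every homomorphism P a -> D l factors through D a, so does the lift,    *)
(* and the image splits off.                                                  *)
Lemma cogenerated_semisimple (I : eqType) (c : I -> Phi) (r : seq I) N
    (g : forall k, {linear N -> D (c k)}) :
  (forall x, (forall k, k \in r -> g k x = 0) -> x = 0) -> semisimple N.
Proof.
elim: r N g => [|k r IHr] N g g_inj.
  exists void, (fun v : void => match v with end).
  by apply: biproduct_zero => x; apply: g_inj.
have [K [j [j_inj jg]]] := kernel_exists (g k).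
(* On the kernel of [g k] the remaining coordinates are jointly injective. *)
have K_ss : semisimple K.
  apply: (IHr K (fun l => lcomp (g l) j)) => x x0.
  apply: (ker_injective j_inj); apply: g_inj => l; rewrite inE => /orP[/eqP->|/x0//].
  by apply/jg; exists x.
have [S SP] := im_submod (g k).
have [|g' g'E] := @lift_inj _ _ _ _ (incl S) (g k) (@incl_inj _ _ S).
  by move=> x; apply/inclP/SP; exists x.
have [gk0|[x gkx]] := zero_or_nonzero (g k).
  have [I' [c' Kc']] := K_ss; exists I', c'.
  apply: biproduct_iso Kc'; apply/isomorphicP; exists j; split=> // x.
  exact/jg.
have [|a [v [v_inj v_surj]]] := Delta_submodule (@incl_inj _ _ S).
  by exists (g' x) => g'x; apply: gkx; rewrite -g'E g'x linear0.
have [w [vK wK]] := inverse_exists v_inj v_surj.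
pose q := lcomp w g'.
have q_surj : surjective_map q.
  move=> y; have /SP[z zE] : incl S (v y) \in S by apply/inclP; exists (v y).
  exists z; apply: v_inj; rewrite lcompE wK; apply: (@incl_inj _ _ S).
  by rewrite g'E.
have jq : exact j q.
  move=> y; rewrite lcompE; split=> [wg'|[z zy]].
    by apply/jg; rewrite -g'E -(wK (g' y)) wg' !linear0.
  rewrite (_ : g' y = 0) ?linear0 //; apply: (@incl_inj _ _ S).
  by rewrite g'E linear0; apply/jg; exists z.
have N_fg := fg_ext q_surj jq (semisimple_fg K_ss) (Delta_fg a).
have [_ Pa_proj _] := P_cover a.
have [h hE] := Pa_proj _ _ q (Delta_proj a) N_fg (Delta_fg a) q_surj.
(* Each coordinate of [h] factors through [D a], and maps from [P b] to [D a] vanish unless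
   [b <= a]. *)
have [|s sE] := factor_Delta (f := h).
  move=> b u ba [u' u'E] y; apply: g_inj => l _.
  have [gh ghE] := cover_map_factor (lcomp (g l) h).
  have := ghE (u' y); rewrite lcompE u'E => <-.
  by rewrite -[Delta_proj a _]lcompE (cover_Delta_zero _ ba) linear0.
have [I' [c' Kc']] := K_ss; exists (option I'), (fun o => oapp c' a o).
apply: (biproduct_cons j_inj jq (s := s)) Kc' => y.
by have [z <-] := Delta_proj_surj y; rewrite sE hE.
Qed.

(* M / X embeds N; the maps N -> D c -> Q t extend to M / X, hence to M, and  *)
(* land in the bottom D m of Q t because D i -> Q t / D m kills X. Together   *)
(* with M -> D i they embed M into a sum of standard modules.                 *)
Lemma extension_semisimple N M X i (j : {linear N -> M}) (g : {linear M -> D i})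
    (w : {linear X -> M}) :
    injective j -> surjective_map g -> exact j g -> semisimple N ->
    injective (lcomp g w) -> (exists x : X, x <> 0) ->
  semisimple M.
Proof.
move=> j_inj g_surj jg N_ss gw_inj [x0 x0N].
have N_fg := semisimple_fg N_ss; have M_fg := fg_ext g_surj jg N_fg (Delta_fg i).
have [I [c [f0 [h [_ _ h_inj]]]]] := N_ss.
have [Z [rho [rho_surj wrho]]] := cokernel_exists w.
(* The image of [w] meets that of [N] only in zero, since [g] is injective on it. *)
have rhoj_inj : injective (lcomp rho j).
  apply: injective_ker => y; rewrite lcompE => /wrho[x wx].
  apply: (ker_injective j_inj); rewrite -wx.
  rewrite (_ : x = 0) ?linear0 //; apply: (ker_injective gw_inj).
  by rewrite lcompE wx; apply/jg; exists y.
have ext k : exists F : {m : Phi & {linear M -> D m}},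
    forall y, tagged F (j y) = 0 -> h k y = 0.
  have [t [sigma [t0 sigma_inj _]]] := Delta_socle (c k).
  have [e [e_inj e_ess]] := simple_Delta_hull t0.
  have [_ Q_inj _] := Q_hull t; have [s sQ] := hull_filtered t0.
  have [phi phiE] := Q_inj _ _ sigma e (Delta_fg t) (Delta_fg (c k)) sigma_inj.
  have [z z0] := Delta_nonzero t.
  have phi_inj : injective phi.
    apply: (Delta_filtered_inj sQ); exists (sigma z).
    by rewrite phiE => /(ker_injective e_inj).
  have Q0 : exists x : Q t, x <> 0 by exists (e z) => /(ker_injective e_inj).
  have [m [r [W [jm [q [jm_inj q_surj jmq rW]]]]]] :=
    filtered_bottom sQ (filtered_nonnil sQ Q0).
  have [Psi PsiE] := Q_inj _ _ _ (lcomp phi (h k)) N_fg (fg_surj rho_surj M_fg) rhoj_inj.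
  (* By essentiality the image of [e] lies in the bottom factor [D m], so [q phi] kills the socle
     [sigma]; it is not injective, hence zero. *)
  have qphi0 y : q (phi y) = 0.
    have [qphi0|qphi] := zero_or_nonzero (lcomp q phi); first exact: qphi0.
    case: z0; apply: (ker_injective sigma_inj).
    apply: (ker_injective (Delta_filtered_inj rW qphi)); rewrite lcompE phiE.
    have [S SP] := im_submod jm; apply/jmq/SP/e_ess.
    have [b b0] := Delta_nonzero m; exists (jm b); first by apply/SP; exists b.
    by move=> /(ker_injective jm_inj).
  pose F := lcomp Psi rho.
  have Fj y : F (j y) = phi (h k y) by rewrite -[RHS]lcompE -PsiE !lcompE.
  have [|psi psiE] := factor_surj g_surj (f := lcomp q F).
    by move=> _ /jg[y <-]; rewrite lcompE Fj qphi0.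
  (* [F] kills the image of [w], so [psi] kills the nonzero image of [g w]. *)
  have psi0 y : psi y = 0.
    have [//|psiN] := zero_or_nonzero psi; case: x0N.
    apply: (ker_injective gw_inj); apply: (ker_injective (Delta_filtered_inj rW psiN)).
    rewrite lcompE psiE !lcompE (_ : rho _ = 0) ?linear0 //.
    by apply/wrho; exists x0.
  have [|f fE] := @lift_inj _ _ _ _ jm F jm_inj.
    by move=> y; apply/jmq; rewrite -lcompE -psiE psi0.
  exists (existT _ m f) => y /= fjy.
  by apply: (ker_injective phi_inj); rewrite -Fj -fE fjy linear0.
have [F FP] := choice ext.
pose G (o : option I) := if o is Some k then F k else existT _ i g.
apply: (@cogenerated_semisimple _ (fun o => tag (G o)) (enum {: option I}) M
  (fun o => tagged (G o))) => x x1.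
have /jg[y yx] : g x = 0 by apply: (x1 None); rewrite mem_enum.
rewrite -yx (h_inj y) ?linear0 // => k; apply: FP; rewrite yx.
by apply: (x1 (Some k)); rewrite mem_enum.
Qed.

(** * Independent simple submodules along a $\Delta$-filtration *)

(** Induction on the filtration. If all the images lie in [K], the bound is strict. Otherwise some
    [u k0] is nonzero in the top factor; the other maps are corrected by it to land in [K], and [A]
    loses [k0]. Equality passes to [K], and [X k0] is the simple submodule needed in
    [extension_semisimple]. *)
Lemma independent_bound s M (I : finType) (X : I -> lmodType B)
    (u : forall k, {linear X k -> M}) (A : {set I}) :
    (forall k, simple_module (X k)) -> filtered D s M ->
    (forall x : forall k, X k, \sum_(k in A) u k (x k) = 0 ->
       forall k, k \in A -> x k = 0) ->
  (#|A| <= size s)%N /\ (#|A| = size s -> semisimple M).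
Proof.
move=> X_simple; elim: s M u A => [|i s IHs] M u A sM u_free.
  have -> : #|A| = 0%N.
    apply: eq_card0 => k; apply/negP => kA; have [y y0] := simple_nonzero (X_simple k).
    case: y0; rewrite -(dfwith_in (fun l => 0 : X l) y).
    by apply: u_free kA; apply: sM.
  split=> // _; exists void, (fun v : void => match v with end).
  exact: biproduct_zero.
have [K [j [g [j_inj g_surj jg sK]]]] := sM.
have [[k0 k0A gu0]|all0] :=
    EM (exists2 k, k \in A & exists y, lcomp g (u k) y <> 0); last first.
  have lift k : exists u' : {linear X k -> K}, k \in A -> forall x, j (u' x) = u k x.
    case: (boolP (k \in A)) => [kA|_]; last by exists \0.
    have [|u' u'E] := @lift_inj _ _ _ _ j (u k) j_inj; last by exists u'.
    move=> x; apply/jg; apply: contrapT => gux; apply: all0; exists k => //.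
    by exists x; rewrite lcompE.
  pose u' k := projT1 (cid (lift k)).
  have u'E k : k \in A -> forall x, j (u' k x) = u k x by rewrite /u'; case: cid.
  have [|A_le _] := IHs K u' A sK.
    move=> x x0; apply: u_free.
    have := congr1 j x0; rewrite linear0 linear_sum => x1; rewrite -[RHS]x1.
    by apply: eq_bigr => k kA; rewrite u'E.
  by split=> [|A_eq]; [exact: leqW | rewrite A_eq /= ltnn in A_le].
have gu0_inj : injective (lcomp g (u k0)) := simple_map_inj (X_simple k0) gu0.
have [t [sigma [_ sigma_inj sigmaP]]] := Delta_socle i.
have [v0 v0E] := sigmaP _ _ gu0_inj (simple_nonzero (X_simple k0)).
have lift k : exists (u' : {linear X k -> K}) (phi : {linear X k -> X k0}),
    forall x, j (u' x) = u k x - u k0 (phi x).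
  (* A nonzero [g u k] and [g u k0] both have the simple socle of [D i] as image, so the former
     factors through the latter. *)
  have [phi phiE] : exists phi : {linear X k -> X k0}, forall x,
      g (u k0 (phi x)) = g (u k x).
    have [gu_zero|gu] := zero_or_nonzero (lcomp g (u k)).
      by exists \0 => x; rewrite -[RHS]lcompE gu_zero !linear0.
    have gu_inj := simple_map_inj (X_simple k) gu.
    have [v vE] := sigmaP _ _ gu_inj (simple_nonzero (X_simple k)).
    have v_surj : surjective_map v.
      have [y y0] := Delta_nonzero t; apply: simple_map_surj => //; exists y => vy.
      by apply: y0; apply: (ker_injective sigma_inj); rewrite -vE vy linear0.
    apply: (@lift_inj _ _ _ _ _ (lcomp g (u k)) gu0_inj) => x.
    by have [y <-] := v_surj x; exists (v0 y); rewrite v0E vE.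
  have [|u' u'E] := @lift_inj _ _ _ _ j (lsub (u k) (lcomp (u k0) phi)) j_inj.
    by move=> x; apply/jg; rewrite lsubE lcompE linearB phiE subrr.
  by exists u', phi => x; rewrite u'E lsubE lcompE.
pose u' k := projT1 (cid (lift k)).
have u'E k : exists phi : {linear X k -> X k0},
    forall x, j (u' k x) = u k x - u k0 (phi x) by rewrite /u'; case: cid.
have [phi phiE] : exists phi : forall k, {linear X k -> X k0},
    forall k x, j (u' k x) = u k x - u k0 (phi k x).
  exists (fun k => projT1 (cid (u'E k))) => k; by case: cid.
have [|A_le A_eq] := IHs K u' (A :\ k0) sK.
  move=> x x0 k /setD1P[kk0 kA].
  (* A relation among the corrected maps becomes one among the [u l] once the corrections are
     collected in the entry at [k0]. *)
  rewrite -(dfwith_out x (- \sum_(l in A :\ k0) phi l (x l)) (i := k0)) 1?eq_sym //.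
  apply: u_free kA; rewrite (big_setD1 k0) //= dfwith_in.
  have := congr1 j x0; rewrite linear0 linear_sum => x0'.
  rewrite linearN linear_sum addrC -[RHS]x0' -sumrB; apply: eq_bigr => l.
  by rewrite phiE => /setD1P[lk0 _]; rewrite dfwith_out // eq_sym.
have A_card : #|A| = #|A :\ k0|.+1 by rewrite (cardsD1 k0 A) k0A.
rewrite A_card /= ltnS; split=> // -[/A_eq K_ss].
apply: (extension_semisimple j_inj g_surj jg K_ss gu0_inj).
exact: simple_nonzero.
Qed.

(** * Socles and filtration lengths of $\Delta$-semisimple modules *)

(** Each summand contributes its simple socle. Conversely, a simple submodule of [M] projects to
    zero or onto the socle in each summand. *)
Lemma semisimple_soc (I : finType) (c : I -> Phi) M :
    biproduct (fun k => D (c k)) M ->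
  exists t : I -> Phi, (forall k, simple_module (D (t k))) /\
    biproduct (fun k => D (t k)) (submodule (Soc M)).
Proof.
move=> [f [g [gf1 gf0 g_inj]]].
pose t k := projT1 (cid (Delta_socle (c k))).
have [sigma sigmaP] : exists sigma : forall k, {linear D (t k) -> D (c k)}, forall k,
    [/\ simple_module (D (t k)), injective (sigma k) &
      forall X (u : {linear X -> D (c k)}), injective u -> (exists x : X, x <> 0) ->
        exists v : {linear D (t k) -> X}, forall x, u (v x) = sigma k x].
  have ex k : exists sigma : {linear D (t k) -> D (c k)},
    [/\ simple_module (D (t k)), injective sigma &
      forall X (u : {linear X -> D (c k)}), injective u -> (exists x : X, x <> 0) ->
        exists v : {linear D (t k) -> X}, forall x, u (v x) = sigma x].
    rewrite /t; case: cid => t' [sigma [t0 s_inj sP]] /=; exists sigma; split=> //.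
    exact: simple_Delta_simple.
  by exists (fun k => projT1 (cid (ex k))) => k; case: cid.
have t_simple k : simple_module (D (t k)) by have [] := sigmaP k.
exists t; split=> //.
have f'_ex k : exists f' : {linear D (t k) -> submodule (Soc M)},
    forall x, incl (Soc M) (f' x) = f k (sigma k x).
  apply: (@lift_inj _ _ _ _ (incl (Soc M)) (lcomp (f k) (sigma k))).
    exact: incl_inj.
  move=> x; apply/inclP; apply/asboolP; have [S SP] := im_submod (lcomp (f k) (sigma k)).
  exists [:: lcomp (f k) (sigma k) x]; last by rewrite big_seq1.
  move=> z; rewrite inE => /eqP->; exists S; last by apply/SP; exists x.
  have fs_inj : injective (lcomp (f k) (sigma k)).
    by have [_ s_inj _] := sigmaP k; apply: inj_comp s_inj; apply: can_inj (gf1 k).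
  have [|h hE] := @lift_inj _ _ _ _ (incl S) (lcomp (f k) (sigma k)) (@incl_inj _ _ S).
    by move=> y; apply/inclP/SP; exists y.
  apply: simple_iso (t_simple k); apply/isomorphicP; exists h; split.
    by move=> y y' yy'; apply: fs_inj; rewrite -!hE yy'.
  move=> y; have /SP[y' y'E] : incl S y \in S by apply/inclP; exists y.
  by exists y'; apply: (@incl_inj _ _ S); rewrite hE.
have g'_ex k : exists g' : {linear submodule (Soc M) -> D (t k)},
    forall z, sigma k (g' z) = g k (incl (Soc M) z).
  have [_ s_inj sP] := sigmaP k.
  apply: (@lift_inj _ _ _ _ (sigma k) (lcomp (g k) (incl (Soc M))) s_inj) => z.
  rewrite lcompE; have [T TP] := im_submod (sigma k); apply/TP.
  have : incl (Soc M) z \in Soc M by apply/inclP; exists z.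
  move=> /asboolP[r rP ->]; rewrite linear_sum big_seq rpred_sum // => y /rP[S S_simple].
  move=> /inclP[y' <-]; have [gS0|gS] := zero_or_nonzero (lcomp (g k) (incl S)).
    by rewrite -lcompE gS0 rpred0.
  have [v vE] := sP _ _ (simple_map_inj S_simple gS) (simple_nonzero S_simple).
  have v_surj : surjective_map v.
    have [x x0] := simple_nonzero (t_simple k); apply: simple_map_surj => //; exists x.
    by move=> vx; apply: x0; apply: (ker_injective s_inj); rewrite -vE vx linear0.
  by have [x <-] := v_surj y'; rewrite -lcompE vE; apply/TP; exists x.
exists (fun k => projT1 (cid (f'_ex k))), (fun k => projT1 (cid (g'_ex k))).
split=> [k x|k l x kl|z z0].
- case: (cid (f'_ex k)) => f' /= f'E; case: (cid (g'_ex k)) => g' /= g'E.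
  by have [_ s_inj _] := sigmaP k; apply: s_inj; rewrite g'E f'E gf1.
- case: (cid (f'_ex k)) => f' /= f'E; case: (cid (g'_ex l)) => g' /= g'E.
  have [_ s_inj _] := sigmaP l; apply: (ker_injective s_inj).
  by rewrite g'E f'E gf0.
apply: (ker_injective (@incl_inj _ _ (Soc M))); apply: g_inj => k.
by have := z0 k; case: (cid (g'_ex k)) => g' /= g'E; rewrite -g'E => ->; rewrite linear0.
Qed.

(** [biproduct_filtered_size] applies with the radical as proper submodule: a map between standard
    modules that is not onto lands in it, and a surjection is injective. *)
Lemma semisimple_filtered_size (I : finType) (c : I -> Phi) s M :
  biproduct (fun k => D (c k)) M -> filtered D s M -> size s = #|I|.
Proof.
apply: biproduct_filtered_size => [k|j]; first exact: Delta_nonzero.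
have [_ [_ _ R_proper _]] := Delta_top j; exists (Rad (D j)); split=> // k h.
have [h_surj|] := map_to_Delta h; [left; split=> // | by right].
apply: Delta_map_inj; have [y y0] := Delta_nonzero j; have [x hx] := h_surj y.
by exists x; rewrite hx.
Qed.

End Standard.

(** The same count with the zero submodule, by Schur's lemma. *)
Lemma simple_decomposition_size (B : pzRingType) (I J : finType)
    (X : I -> lmodType B) (Y : J -> lmodType B) (M : lmodType B) :
    (forall k, simple_module (X k)) -> (forall k, simple_module (Y k)) ->
  biproduct X M -> biproduct Y M -> #|J| = #|I|.
Proof.
move=> X_simple Y_simple XM /biproduct_filtered YM.
rewrite cardE; apply: biproduct_filtered_size XM YM => [k|j].
  exact: simple_nonzero.
have [S SP] : exists S : submodClosed (Y j), forall y, y \in S <-> y = 0.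
  by apply: submod_bundle => // a x y -> ->; rewrite scaler0 addr0.
exists S; split=> [S1|k h].
  by have [y y0] := simple_nonzero (Y_simple j); apply/y0/SP/S1.
have [h0|hN] := zero_or_nonzero h; [right=> x; exact/SP | left].
by split; [apply: simple_map_inj | apply: simple_map_surj].
Qed.

(** * Socle length against filtration length, and passage to submodules *)

Theorem corollary3p3 (d : Order.disp_t) (Phi : finPOrderType d)
    (B : pzRingType) (L P Q : Phi -> lmodType B)
    (B_artin : artin_algebra B)
    (L_simple : represents_simples L)
    (P_cover : forall i : Phi, is_projective_cover (P i) (L i))
    (Q_hull : forall i : Phi, is_injective_hull (Q i) (L i))
    (B_RUSQ : RUSQ L P Q) :
  (forall M : lmodType B, finitely_generated M -> in_F_Delta P M ->
     (Delta_semisimple P M <->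
      nb_simple_summands (submodule (Soc M)) = Delta_length P M))
  /\
  (forall (M : lmodType B) (N : submodClosed M),
     finitely_generated M -> Delta_semisimple P M ->
     Delta_semisimple P (submodule N)).
Proof.
have [qh Rad_F Q_F] := B_RUSQ.
have mult1 i : comp_mult (Delta P i) (L i) = 1%N by have [] := qh i.
split=> [M _ M_F|M N _ /semisimpleP[I [c [f [g [_ _ g_inj]]]]]]; last first.
  apply/semisimpleP.
  (* The coordinates on [M] restrict to jointly injective maps on [N]. *)
  apply: (cogenerated_semisimple L_simple P_cover mult1 Q_hull Rad_F Q_F
    (r := enum I) (g := fun k => lcomp (g k) (incl N))) => x x0.
  apply: (ker_injective (@incl_inj _ _ N)); apply: g_inj => k.
  by apply: x0; rewrite mem_enum.
have [n [c cM]] := M_F.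
split=> [/semisimpleP[I [c' c'M]]|nb_len].
  have len n' (c1 : 'I_n' -> Phi) : Delta_filtration P M c1 -> n' = #|I|.
    move=> /Delta_filtration_filtered[s [<-]].
    exact: (semisimple_filtered_size L_simple P_cover mult1 Rad_F c'M).
  have [t [t_simple tS]] :=
    semisimple_soc L_simple P_cover mult1 Q_hull Rad_F Q_F c'M.
  rewrite /Delta_length /nb_simple_summands (@xget_unique _ _ _ #|I|); first last.
  - move=> m [X [X_simple /biproductP XS]].
    by rewrite -(simple_decomposition_size t_simple X_simple tS XS) card_ord.
  - exists (fun k => Delta P (t (enum_val k))); split=> //; apply/biproductP.
    exact: (biproduct_reindex (@enum_val_bij I)) tS.
  by apply/esym/xget_unique => [|m [c1 /len//]]; rewrite -(len n c cM); exists c.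
(* Membership in $\mathcal{F}(\Delta)$ excludes the default value of [xget]. *)
have [c1 c1M] : exists c1 : 'I_(Delta_length P M) -> Phi, Delta_filtration P M c1.
  rewrite /Delta_length; case: xgetP => [m _ //|noM].
  by case: (noM n); exists c.
have [s [s_size sM]] := Delta_filtration_filtered c1M.
apply/semisimpleP; move: nb_len; rewrite -s_size /nb_simple_summands.
case: xgetP => [m _ [X [X_simple /biproductP[f [g [gf1 gf0 _]]]]] m_s|_ s0].
  have [] := independent_bound L_simple P_cover mult1 Q_hull Rad_F Q_F
    (u := fun k => lcomp (incl (Soc M)) (f k)) (A := [set: 'I_m]) X_simple sM.
    move=> x x0 l _.
    have fx0 : \sum_k f k (x k) = 0.
      apply: (ker_injective (@incl_inj _ _ (Soc M))); rewrite linear_sum -[RHS]x0.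
      by apply: eq_big => k; rewrite ?inE // lcompE.
    have := congr1 (g l) fx0; rewrite linear0 linear_sum (bigD1 l) //= gf1.
    by rewrite big1 ?addr0 // => k kl; rewrite gf0.
  by rewrite cardsT card_ord => _; apply.
(* In the default case of [xget] the common value is [0], so the filtration is empty and [M] is
   zero. *)
exists void, (fun v : void => match v with end); apply: biproduct_zero.
by move: sM; rewrite (size0nil (esym s0)).
Qed.
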